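(* Let $r$ be a positive integer, $\gamma$ an $r$-core, and $\mathbf{RH}(\gamma)$ the set of partitions $\lambda$ with $\gamma\le_r\lambda$. Then, with indeterminates $X=(X_i)_{i\in\mathbb{N}}$ and $Y=(Y_j)_{j\in\mathbb{N}}$, $$\prod_{i,j\in\mathbb{N}}\prod_{k=0}^{r-1}(1+q^kX_iY_j)=\sum_{\lambda\in\mathbf{RH}(\gamma)}G^{(r)}_{\lambda/\gamma}(q^{1/2},X)\,\widetilde G^{(r)}_{\lambda/\gamma}(q^{1/2},Y).$$
   Context: Partitions are identified with their Young diagrams (square $(i,j)$ in row $i$, column $j$, both numbered from $0$; rows numbered downwards). Diagonal $d_k$ is $\{(i,j):j-i=k\}$. For $\lambda\subset\mu$, $\mu/\lambda$ is an $r$-ribbon (written $\lambda\prec_r\mu$) if the skew diagram consists of exactly one square on each of $r$ consecutive diagonals; its head is its top-rightmost square, and its height is one less than the number of rows it meets. $\le_r$ is the reflexive transitive closure of $\prec_r$; an $r$-core is a minimal element for $\le_r$. $\mu/\lambda$ is a horizontal (respectively vertical) $r$-ribbon strip, written $\lambda\leftharpoondown_r\mu$ (respectively $\lambda\leftharpoonup_r\mu$), if there is a (possibly trivial) chain $\lambda=\lambda^{(0)}\prec_r\cdots\prec_r\lambda^{(p)}=\mu$ such that, with $d_{k_t}$ the diagonal containing the head of $\lambda^{(t)}/\lambda^{(t-1)}$, one has $k_1<\cdots<k_p$ (respectively $k_1>\cdots>k_p$). Such a chain is unique, and called the standardisation of $\mu/\lambda$ as a horizontal (respectively vertical) strip.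 In either case $|\mu/\lambda|_r=p$, and $\mathrm{spin}(\mu/\lambda)$ (respectively $\mathrm{spin}^{\mathrm t}(\mu/\lambda)$) is half the sum of the heights of the ribbons in that standardisation. A semistandard (respectively transpose semistandard) $r$-ribbon tableau of shape $\lambda/\gamma$ is a finite sequence $\gamma=\lambda^0,\lambda^1,\dots,\lambda^n=\lambda$ with $\lambda^j\leftharpoondown_r\lambda^{j+1}$ (respectively $\lambda^j\leftharpoonup_r\lambda^{j+1}$) for all $j<n$ (repetitions allowed), where sequences differing only by repetitions of $\lambda$ at the end are identified. For a semistandard such tableau $P$, $\mathrm{spin}(P)=\sum_j\mathrm{spin}(\lambda^{j+1}/\lambda^j)$, and for a transpose semistandard one $Q$, $\mathrm{spin}^{\mathrm t}(Q)=\sum_j\mathrm{spin}^{\mathrm t}(\lambda^{j+1}/\lambda^j)$; in both cases $X^{\mathrm{wt}}=\prod_jX_j^{|\lambda^{j+1}/\lambda^j|_r}$, and similarly for $Y$. Then $$G^{(r)}_{\lambda/\gamma}(q^{1/2},X)=\sum_Pq^{\mathrm{spin}(P)}X^{\mathrm{wt}(P)},\qquad \widetilde G^{(r)}_{\lambda/\gamma}(q^{1/2},Y)=\sum_Qq^{\mathrm{spin}^{\mathrm t}(Q)}Y^{\mathrm{wt}(Q)},$$ where $P$ (respectively $Q$) runs over all semistandard (respectively transpose semistandard) $r$-ribbon tableaux of shape $\lambda/\gamma$. *)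

(* Defs.v *)
(* MathComp world: the classical library provides finitely supported sums, and
   monalg polynomials in infinitely many variables. *)
From HB Require Import structures.
From mathcomp Require Import all_boot all_order all_algebra finmap.
From mathcomp Require Import boolp classical_sets functions cardinality fsbigop.
From mathcomp Require Import monalg.

Set Implicit Arguments.
Unset Strict Implicit.
Unset Printing Implicit Defensive.

Import Order.TTheory GRing.Theory Num.Theory.

Local Open Scope classical_set_scope.
Local Open Scope ring_scope.

(** * Partitions and Young diagrams *)

Definition is_part (s : seq nat) : bool := sorted geq s && (0%N \notin s).

Record part : predArgType := Part { parts :> seq nat; partsP : is_part parts }.

HB.instance Definition _ := [isSub for parts].
HB.instance Definition _ := [Choice of part by <:].

Definition square : Type := (nat * nat)%type.

(* Row by row from top to bottom, each row from left to right. *)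
Definition young (la : part) : seq square :=
  [seq (i, j) | i <- iota 0 (size la), j <- iota 0 (nth 0%N la i)].

Definition skew_squares (la mu : part) : seq square :=
  [seq s <- young mu | s \notin young la].

(* [s] lies on the diagonal d_k for k = content s. *)
Definition content (s : square) : int := s.2%:Z - s.1%:Z.

(** * Ribbons *)

(* la \prec_r mu.  The right-hand side of the count is a boolean read as
   0 or 1: mu/la has one square on each diagonal d_c, .., d_(c+r-1) and none on
   any other. *)
Definition ribbon (r : nat) : rel part := fun la mu =>
  `[< {subset young la <= young mu} /\
     exists c : int, forall k : int,
       count (fun s => content s == k) (skew_squares la mu)
         = (c <= k < c + r%:Z) >].

(* The top-rightmost square of a ribbon: the square weakly above and weakly to
   the right of all others (junk value (0, 0) if there is none). *)
Definition ribbon_head (la mu : part) : square :=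
  nth (0%N, 0%N) (skew_squares la mu)
    (find (fun s : square =>
       all (fun t : square => (s.1 <= t.1)%N && (t.2 <= s.2)%N)
           (skew_squares la mu))
       (skew_squares la mu)).

Definition ribbon_height (la mu : part) : nat :=
  (size (undup [seq s.1 | s : square <- skew_squares la mu])).-1.

(* la \le_r mu *)
Definition ribbon_le (r : nat) (la mu : part) : Prop :=
  exists c : seq part, path (ribbon r) la c /\ last la c = mu.

Definition is_core (r : nat) (ga : part) : Prop :=
  forall ka : part, ribbon_le r ka ga -> ka = ga.

Definition RH (r : nat) (ga : part) : set part := [set la | ribbon_le r ga la].

(** * Ribbon strips *)

(* In this section and the next, the parameter [ord] is the order imposed on
   the diagonals of the successive heads: [<%R] gives the horizontal (resp.
   semistandard) notions and [>%R] the vertical (resp. transpose semistandard)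
   ones. *)

(* The chain la = la^(0), .., la^(p) = mu is encoded as
   c = [:: la^(1); ..; la^(p)]. *)
Definition is_standardisation (ord : rel int) (r : nat) (la mu : part)
    (c : seq part) : Prop :=
  [/\ path (ribbon r) la c, last la c = mu &
      sorted ord (pairmap (fun ka nu => content (ribbon_head ka nu)) la c)].

Definition strip (ord : rel int) (r : nat) : rel part := fun la mu =>
  `[< exists c, is_standardisation ord r la mu c >].

(* The standardisation of a strip ([::] if mu/la is not a strip). *)
Definition standardisation (ord : rel int) (r : nat) (la mu : part) :
    seq part :=
  xget [::] [set c | is_standardisation ord r la mu c].

(* |mu/la|_r *)
Definition strip_size (ord : rel int) (r : nat) (la mu : part) : nat :=
  size (standardisation ord r la mu).

(* Twice spin(mu/la), resp. twice spin^t(mu/la): the sum of the heights,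
   without the factor 1/2, so that q^spin is (q^(1/2))^(spin2). *)
Definition strip_spin2 (ord : rel int) (r : nat) (la mu : part) : nat :=
  sumn (pairmap ribbon_height la (standardisation ord r la mu)).

(** * Ribbon tableaux *)

(* A tableau ga = la^0, la^1, .., la^n = la is encoded as
   P = [:: la^1; ..; la^n].  Sequences differing only by repetitions of la at
   the end are identified by retaining only the shortest one, i.e., the one
   that does not end with a repetition of the entry before the last. *)
Definition ribbon_tableau (ord : rel int) (r : nat) (la ga : part) :
    set (seq part) :=
  [set P | [/\ path (strip ord r) ga P, last ga P = la &
               forall P' : seq part, P <> rcons P' (last ga P')]].

Definition tableau_spin2 (ord : rel int) (r : nat) (ga : part)
    (P : seq part) : nat :=
  \sum_(j < size P) strip_spin2 ord r (nth ga (ga :: P) j) (nth ga P j).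

(** * Power series in the X_i and Y_j over Z[q^(1/2)] *)

Definition coef : comNzRingType := {poly int}.
Definition qhalf : coef := 'X.
Definition q : coef := qhalf ^+ 2.

(* Polynomials in the X_i and Y_j, [inl i] being the index of X_i and [inr j]
   that of Y_j. *)
Definition monom : conomType := {cmonom (nat + nat)%type}.
Definition varX (i : nat) : {malg coef[monom]} := << ucm (inl i) >>.
Definition varY (j : nat) : {malg coef[monom]} := << ucm (inr j) >>.

(* Arbitrary families of coefficients, with coefficientwise (discrete)
   convergence. *)
Definition fps : Type := monom -> coef.

Definition fps_of (p : {malg coef[monom]}) : fps := fun m => p@_m.

(* Cauchy product; the index set is finite. *)
Definition fps_mul (f g : fps) : fps := fun m =>
  \sum_(p \in [set p : monom * monom | mmul p.1 p.2 = m]) f p.1 * g p.2.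

Definition fps_summable (I : choiceType) (A : set I) (F : I -> fps) : Prop :=
  forall m : monom, finite_set (A `&` [set i | F i m != 0]).

(* Only meaningful for summable families. *)
Definition fps_sum (I : choiceType) (A : set I) (F : I -> fps) : fps :=
  fun m => \sum_(i \in A) F i m.

(* The unordered product of the F i converges to s: every coefficient of the
   finite subproducts is eventually equal to that of s. *)
Definition has_prod (I : choiceType) (F : I -> {malg coef[monom]}) (s : fps) :
    Prop :=
  forall m : monom, exists J0 : {fset I}, forall J : {fset I},
    (J0 `<=` J)%fset -> fps_of (\prod_(i <- J) F i) m = s m.

(** * The generating series *)

(* q^spin(P) Z^wt(P) *)
Definition tableau_term (ord : rel int) (r : nat)
    (Z : nat -> {malg coef[monom]}) (ga : part) (P : seq part) : fps :=
  fps_of (qhalf ^+ tableau_spin2 ord r ga P *: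
    \prod_(j < size P) Z j ^+ strip_size ord r (nth ga (ga :: P) j)
                                               (nth ga P j)).

Definition G (r : nat) (la ga : part) (Z : nat -> {malg coef[monom]}) : fps :=
  fps_sum (ribbon_tableau <%R r la ga) (tableau_term <%R r Z ga).

Definition Gt (r : nat) (la ga : part) (Z : nat -> {malg coef[monom]}) : fps :=
  fps_sum (ribbon_tableau >%R r la ga) (tableau_term >%R r Z ga).

(* Main.v *)
(* A partition is read as a configuration of beads, and adding an r-ribbon
   moves a bead from a free position k to k + r past [height] other beads.  Let
   U(x) and D(y) be the ordered products over increasing k of the operators
   1 + x u_k and 1 + y d_k, where u_k and d_k move a bead from k to k + r and
   back, weighted by q^(height/2).  Their matrix coefficients are the weights of
   horizontal and of (reversed) vertical strips.  The factors with different k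
   commute, while for equal k interchanging them changes
   prod_(j < b) (1 + q^j x y), for b the number of beads on k, .., k + r - 1,
   into the same product for k + 1.  These relations telescope, b decreasing
   from r far to the left to 0 far to the right, so that
   U(x) D(y) = prod_(j < r) (1 + q^j x y) D(y) U(x).  Finitely many variables
   follow by evaluating U(x_0) .. U(x_(N-1)) D(y_(N-1)) .. D(y_0) at the core,
   and the coefficient of a given monomial only involves finitely many
   variables. *)
Require Import Defs.
From mathcomp Require Import all_boot all_order all_algebra finmap.
From mathcomp Require Import boolp classical_sets functions cardinality fsbigop.
From mathcomp Require Import monalg.
From mathcomp Require Import zify ring.

Set Implicit Arguments.
Unset Strict Implicit.
Unset Printing Implicit Defensive.

Import Order.TTheory GRing.Theory Num.Theory.

Local Open Scope ring_scope.

(** * Bead counts *)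

(** Partitions are handled through the counts [beads la c] instead of sets of beads: moving a bead
    from [k] to [k + r] adds 1 to the counts on the interval from [k + 1] to [k + r] and nothing
    elsewhere, so ribbons, heights and commutations become linear arithmetic. The operators act on
    functions on partitions, not on formal sums, and only a finite window of positions is used, so
    nothing infinite occurs. The price is that the telescoped relation holds only where both ends of
    the window look right: on the left the partition must have all its beads ([full]), on the right
    the function must vanish on partitions with beads there ([supp]). Each [U] costs [r] positions
    of the left margin and each [D] costs [r] of the right one, so [N] variables of each kind need
    margins of [r * N]. The factor [1 + q^h x y] comes from moving a bead out and back past [h]
    others, at the cost [q^(h/2)] each way. After the interchange only trivial moves contribute at
    the core, which leaves the bare product. *)

Definition row (la : part) (i : nat) : nat := nth 0%N la i.

Lemma row_default (la : part) i : (size la <= i)%N -> row la i = 0%N.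
Proof. exact: nth_default. Qed.

Lemma row_gt0 (la : part) i : (0 < row la i)%N = (i < size la)%N.
Proof.
have [lt_i|ge_i] := ltnP i (size la); last by rewrite row_default.
have /andP[_ nz] := partsP la.
rewrite lt0n; apply: contra nz => /eqP <-; exact: mem_nth.
Qed.

Lemma leq_row (la : part) i j : (i <= j)%N -> (row la j <= row la i)%N.
Proof.
move=> le_ij; have [lt_j|/row_default-> //] := ltnP j (size la).
have /andP[srt _] := partsP la.
have geq_trans : transitive geq by move=> a b c /= h1 h2; exact: leq_trans h2 h1.
by apply: (sorted_leq_nth geq_trans _ _ srt); rewrite ?inE //; [exact: leqnn|exact: leq_ltn_trans lt_j].
Qed.

Lemma part_eqP (la mu : part) : (forall i, row la i = row mu i) -> la = mu.
Proof.
move=> eq_row; apply: val_inj; apply: (@eq_from_nth _ 0%N) => [|i _]; last exact: eq_row.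
apply/eqP; rewrite eqn_leq; apply/andP; split; rewrite leqNgt; apply/negP.
  by rewrite -row_gt0 eq_row row_gt0 ltnn.
by rewrite -row_gt0 -eq_row row_gt0 ltnn.
Qed.

Lemma part_of_rows (f : nat -> nat) n :
  (forall i, f i.+1 <= f i)%N -> f n = 0%N -> exists la : part, forall i, row la i = f i.
Proof.
move=> f_dec fn0; have ex0 : exists n, f n == 0%N by exists n; apply/eqP.
case: (ex_minnP ex0) => m /eqP fm0 m_min {n fn0 ex0}.
have f_mono i j : (i <= j)%N -> (f j <= f i)%N.
  by move=> /subnK <-; elim: (j - i)%N => // d IH; apply: leq_trans (f_dec _) IH.
have mP : is_part (mkseq f m).
  apply/andP; split.
    by apply: (@homo_sorted _ _ f leq geq) (iota_sorted 0 m) => i j; exact: f_mono.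
  apply/negP => /mapP [i]; rewrite mem_iota add0n => lt_im /esym/eqP/m_min.
  by rewrite leqNgt; case/andP: lt_im => _ ->.
exists (Part mP) => i; rewrite /row /=.
have [lt_im|le_mi] := ltnP i m; first by rewrite nth_mkseq.
by rewrite nth_default ?size_mkseq //; apply/esym/eqP; rewrite -leqn0 -fm0 f_mono.
Qed.

(* The number of rows of [la] ending weakly to the right of the diagonal
   [d_c]; reading [row la i - i - 1] as the position of the i-th bead on an
   abacus, it counts the beads at positions [>= c]. *)
Definition beads (la : part) (c : int) : nat :=
  find (fun i => (row la i)%:Z <= c + i%:Z) (iota 0 (size la + `|c|).+1).

Lemma ltn_beads (la : part) (c : int) i : (i < beads la c)%N = (c + i%:Z < (row la i)%:Z).
Proof.
set p := fun i => (row la i)%:Z <= c + i%:Z.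
have p_mono a b : (a <= b)%N -> p a -> p b.
  by rewrite /p => le_ab; have := leq_row la le_ab; lia.
have hasp : has p (iota 0 (size la + `|c|).+1).
  apply/hasP; exists (size la + `|c|)%N; first by rewrite mem_iota; lia.
  by rewrite /p row_default; lia.
have nf : p (beads la c).
  have := nth_find 0%N hasp; rewrite nth_iota //.
  by rewrite has_find size_iota in hasp.
apply/idP/idP => [lt_i|].
  have := before_find 0%N lt_i; rewrite nth_iota; first by rewrite add0n /p; lia.
  by rewrite has_find size_iota in hasp; apply: ltn_trans lt_i hasp.
rewrite ltNge -[X in ~~ X]/(p i) ltnNge; apply: contra => le_i; exact: p_mono nf.
Qed.

Lemma ltn_row (la : part) i j : (j < row la i)%N = (i < beads la (j%:Z - i%:Z)%R)%N.
Proof. by rewrite ltn_beads; lia. Qed.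

Lemma eqn_of_ltn a b : (forall i, (i < a)%N = (i < b)%N) -> a = b.
Proof. by move=> E; apply/eqP; have := E a; have := E b; lia. Qed.

Lemma leq_of_ltn a b : (forall i, (i < a)%N -> (i < b)%N) -> (a <= b)%N.
Proof. by move=> E; rewrite leqNgt; apply/negP => /E; rewrite ltnn. Qed.

Lemma beads_inj (la mu : part) : (forall c : int, beads la c = beads mu c) -> la = mu.
Proof.
by move=> E; apply: part_eqP => i; apply: eqn_of_ltn => j; rewrite !ltn_row E.
Qed.

(** The drop from [c] to [c + 1] is the number of beads at position [c], at most one because the
    rows weakly decrease. Throughout, [beads la c != beads la (c + 1)] therefore means that [c] is
    occupied. *)
Lemma beadsS (la : part) (c c' : int) : c' = c + 1 ->
  (beads la c' <= beads la c <= (beads la c').+1)%N.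
Proof.
move=> ->; apply/andP; split; apply: leq_of_ltn => i.
  by rewrite !ltn_beads; lia.
case: i => // i; rewrite ltnS !ltn_beads.
by have := leq_row la (leqnSn i); lia.
Qed.

Lemma beads_step (g : int -> nat) (c c' : int) :
  (forall c c' : int, c' = c + 1 -> (g c' <= g c <= (g c').+1)%N) -> c <= c' ->
  (g c' <= g c)%N /\ (g c)%:Z <= (g c')%:Z + (c' - c).
Proof.
move=> gS le_c; have [d] : exists d : nat, c' = c + d%:Z by exists `|c' - c|%N; lia.
elim: d c' le_c => [|d IH] c' le_c def_c'.
  by have -> : c' = c by [lia]; split; lia.
pose b := c' - 1; have [||h1 h2] := IH b; rewrite /b; try lia.
have := gS b c'; move: h1 h2; rewrite /b; move: (g _) (g _) (g _) => x y z h1 h2 h3.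
by split; lia.
Qed.

Lemma beads_anti (la : part) (c c' : int) : c <= c' -> (beads la c' <= beads la c)%N.
Proof. by case/(beads_step (beadsS la)). Qed.

Lemma beads_lip (la : part) (c c' : int) : c <= c' ->
  (beads la c)%:Z <= (beads la c')%:Z + (c' - c).
Proof. by case/(beads_step (beadsS la)). Qed.

Lemma beads_ge (la : part) (c : int) : - c <= (beads la c)%:Z.
Proof.
have [le0|] := leP (- c) 0; first by lia.
by move=> gt0; have := ltn_beads la c `|c|.-1; lia.
Qed.

Lemma beads_hi (la : part) (c : int) : (row la 0)%:Z <= c -> beads la c = 0%N.
Proof. by have := ltn_beads la c 0; lia. Qed.

Lemma beads_lo (la : part) (c : int) : c <= - (size la)%:Z -> (beads la c)%:Z = - c.
Proof.
move=> h; have := beads_ge la c; have := ltn_beads la c `|c|.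
by rewrite row_default; lia.
Qed.

(** Unit drops, 0 far to the right and [- c] far to the left characterise bead counts. The partition
    is rebuilt by putting the square [(i, j)] into the diagram when [i < g (j - i)]. *)
Lemma part_of_beads (g : int -> nat) (M L : int) :
  (forall c c' : int, c' = c + 1 -> (g c' <= g c <= (g c').+1)%N) ->
  (forall c : int, M <= c -> g c = 0%N) ->
  (forall c : int, c <= L -> (g c)%:Z = - c) ->
  exists la, forall c : int, beads la c = g c.
Proof.
move=> gS ghi glo.
have gD (c c' : int) := @beads_step g c c' gS.
have g_ge (c : int) : - c <= (g c)%:Z.
  have [/glo|h] := leP c L; first by lia.
  by have [_] := gD L c (ltW h); have := glo L (lexx _); lia.
pose p i j := (i < g (j%:Z - i%:Z)%R)%N.
have pj i j j' : (j <= j')%N -> p i j' -> p i j.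
  move=> le_j; rewrite /p; case: (gD (j%:Z - i%:Z) (j'%:Z - i%:Z)); lia.
have pi i j : p i.+1 j -> p i j.
  by rewrite /p; have := gS (j%:Z - i.+1%:Z) (j%:Z - i%:Z); lia.
pose f i := find (fun j => ~~ p i j) (iota 0 (`|M| + i).+1).
have fP i j : (j < f i)%N = p i j.
  have hasp : has (fun j => ~~ p i j) (iota 0 (`|M| + i).+1).
    apply/hasP; exists (`|M| + i)%N; first by rewrite mem_iota; lia.
    by rewrite /p ghi; lia.
  have nf : ~~ p i (f i).
    have := nth_find 0%N hasp; rewrite nth_iota //.
    by rewrite has_find size_iota in hasp.
  apply/idP/idP => [lt_j|].
    have := before_find 0%N lt_j; rewrite nth_iota; first by rewrite add0n; case: (p i j).
    by rewrite has_find size_iota in hasp; apply: ltn_trans lt_j hasp.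
  by apply: contraTT; rewrite -leqNgt => le_j; apply: contra nf; apply: pj.
have [||la laP] := @part_of_rows f `|L|.
- by move=> i; apply: leq_of_ltn => j; rewrite !fP; apply: pi.
- apply/eqP; rewrite -leqn0; apply: leq_of_ltn => j; rewrite fP /p => h.
  have := glo (- `|L|%:Z); case: (gD (- `|L|%:Z) (j%:Z - `|L|%:Z)); lia.
exists la => c; apply: eqn_of_ltn => i; rewrite ltn_beads laP.
have [ci0|ci0] := ltP (c + i%:Z) 0; first by have := g_ge c; lia.
have := fP i `|(c + i%:Z)%R|%N; rewrite /p (_ : _ - _ = c); lia.
Qed.

(** * Ribbons as bead moves *)

Lemma mem_young (la : part) (s : square) :
  (s \in young la) = (s.1 < beads la (content s))%N.
Proof.
case: s => i j; rewrite /content /= -ltn_row.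
apply/allpairsPdep/idP => [[a [b [_ + [-> ->]]]]|]; first by rewrite mem_iota.
move=> lt_j; exists i, j; rewrite !mem_iota /= add0n; split=> //.
by rewrite -row_gt0; apply: leq_ltn_trans lt_j.
Qed.

Lemma uniq_young (la : part) : uniq (young la).
Proof.
apply: allpairs_uniq_dep => [|i _|[a b] [c d] _ _ /= [-> ->]] //; exact: iota_uniq.
Qed.

Lemma young_sub (la mu : part) :
  {subset young la <= young mu} <-> (forall c, beads la c <= beads mu c)%N.
Proof.
split=> [sub c|le_b s]; last by rewrite !mem_young => /leq_trans-> //.
apply: leq_of_ltn => i lt_i; have [ci0|ci0] := ltP (c + i%:Z) 0.
  by rewrite ltn_beads; lia.
have /sub : (i, `|(c + i%:Z)%R|%N) \in young la.
  by rewrite mem_young /content /= (_ : _ - _ = c); lia.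
by rewrite mem_young /content /= (_ : _ - _ = c); lia.
Qed.

Lemma mem_skew (la mu : part) (s : square) :
  (s \in skew_squares la mu) =
  (beads la (content s) <= s.1 < beads mu (content s))%N.
Proof. by rewrite mem_filter !mem_young -leqNgt. Qed.

Lemma count_skew (la mu : part) (k : int) :
  count (fun s => content s == k) (skew_squares la mu) = (beads mu k - beads la k)%N.
Proof.
pose sq i : square := (i, `|(k + i%:Z)%R|%N).
have sqK i : (beads la k <= i)%N -> content (sq i) = k.
  by have := beads_ge la k; rewrite /content /=; lia.
rewrite -size_filter -(size_iota (beads la k) (_ - _)) -(size_map sq).
apply/perm_size/uniq_perm.
- by rewrite !filter_uniq // uniq_young.
- by rewrite map_inj_uniq ?iota_uniq // => i j [].
move=> [i j]; rewrite mem_filter mem_skew /=; apply/andP/mapP => [[/eqP Es]|[a]].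
  rewrite Es => h; exists i; first by rewrite mem_iota; lia.
  by move: Es; rewrite /sq /content /= => <-; congr (_, _); lia.
rewrite mem_iota => h [Ei Ej]; have -> : content (i, j) = k.
  by rewrite Ei Ej -[RHS](sqK a) //; lia.
by rewrite eqxx Ei; split=> //; lia.
Qed.

(* [mu] arises from [la] by moving the bead at position [k] to [k + r]. *)
Definition moves (r : nat) (k : int) (la mu : part) : Prop :=
  forall c : int, beads mu c = (beads la c + (k < c <= k + r%:Z)%R)%N.

(** When the diagrams are nested, [mu/la] has [beads mu c - beads la c] squares on [d_c], so a
    ribbon is a rise of the count by one on an interval of length [r]; the bead starts just before
    the first of these diagonals. *)
Lemma ribbonP (r : nat) (la mu : part) :
  ribbon r la mu <-> exists k, moves r k la mu.
Proof.
rewrite /ribbon; split=> [/asboolP[/young_sub le_b [c cP]]|[k kP]].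
  exists (c - 1) => d; have := cP d; have := le_b d; rewrite count_skew.
  by have -> : (c - 1 < d <= c - 1 + r%:Z) = (c <= d < c + r%:Z) by [lia]; lia.
apply/asboolP; split; first by apply/young_sub => c; rewrite kP leq_addr.
exists (k + 1) => c; rewrite count_skew kP.
by have -> : (k < c <= k + r%:Z) = (k + 1 <= c < k + 1 + r%:Z) by [lia]; lia.
Qed.

(** Counts drop by 0 or 1 at each position both before and after the move; at the ends of the
    interval this forces [k] to be occupied and [k + r] to be free in [la]. *)
Lemma moves_bead (r : nat) (k : int) (la mu : part) : (0 < r)%N ->
  moves r k la mu ->
  beads la k = (beads la (k + 1)%R).+1 /\
  beads la (k + r%:Z) = beads la (k + r%:Z + 1).
Proof.
move=> r0 kP.
have := beadsS la (erefl (k + 1)); have := beadsS mu (erefl (k + 1)).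
have := beadsS la (erefl (k + r%:Z + 1)); have := beadsS mu (erefl (k + r%:Z + 1)).
rewrite !kP.
rewrite (_ : (k < k <= k + r%:Z) = false); last by lia.
rewrite (_ : (k < k + 1 <= k + r%:Z) = true); last by lia.
rewrite (_ : (k < k + r%:Z <= k + r%:Z) = true); last by lia.
rewrite (_ : (k < k + r%:Z + 1 <= k + r%:Z) = false); last by lia.
by lia.
Qed.

Lemma mem_skew_moves (r : nat) (k : int) (la mu : part) (s : square) :
  moves r k la mu ->
  (s \in skew_squares la mu) =
  (k < content s <= k + r%:Z) && (s.1 == beads la (content s)).
Proof. by move=> kP; rewrite mem_skew kP; case: (_ < _ <= _) => /=; lia. Qed.

(** The square of the ribbon on [d_c] lies in row [beads la c]. As [c] grows, this row weakly
    decreases, by at most one per step, so the column weakly increases and the last diagonal carries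
    the head. *)
Lemma ribbon_headP (r : nat) (k : int) (la mu : part) : (0 < r)%N ->
  moves r k la mu -> content (ribbon_head la mu) = k + r%:Z.
Proof.
move=> r0 kP; rewrite /ribbon_head; set p := fun s : square => all _ _.
pose h := k + r%:Z; have := beads_ge la h.
pose s0 : square := (beads la h, `|(h + (beads la h)%:Z)%R|%N) => hge.
have s0c : content s0 = h by rewrite /content /=; lia.
have s0in : s0 \in skew_squares la mu.
  by rewrite (mem_skew_moves _ kP) s0c eqxx /h; lia.
have ps0 : p s0.
  apply/allP => t; rewrite (mem_skew_moves _ kP) => /andP[/andP[t1 t2] /eqP t3].
  have th : content t <= h by [].
  have := beads_anti la th; have := beads_lip la th; rewrite -t3 /=.
  by move: th; rewrite /content; lia.
have hasp : has p (skew_squares la mu) by apply/hasP; exists s0.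
have := nth_find (0%N, 0%N) hasp; set s := nth _ _ _ => ps.
have sin : s \in skew_squares la mu by rewrite mem_nth // -has_find.
have := allP ps _ s0in; have := allP ps0 _ sin.
by move: s0c; rewrite /content -/h /=; lia.
Qed.

(** The rows met fill the whole interval between the counts at [k + r] and at [k + 1], since counts
    change by at most one per step. The height is thus the number of beads strictly between [k] and
    [k + r]. *)
Lemma ribbon_heightP (r : nat) (k : int) (la mu : part) : (0 < r)%N ->
  moves r k la mu ->
  ribbon_height la mu = (beads la (k + 1)%R - beads la (k + r%:Z)%R)%N.
Proof.
move=> r0 kP; rewrite /ribbon_height.
set a := beads la (k + 1); set b := beads la (k + r%:Z).
have le_ba : (b <= a)%N by apply: beads_anti; lia.
rewrite -[RHS]/((a - b).+1.-1) -(size_iota b (a - b).+1); congr _.-1.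
apply/perm_size/uniq_perm; rewrite ?undup_uniq ?iota_uniq // => i.
rewrite mem_undup mem_iota; apply/mapP/idP => [[s + ->]|/andP[le_bi le_ia]].
  rewrite (mem_skew_moves _ kP) => /andP[/andP[t1 t2] /eqP->].
  have := @beads_anti la (content s) (k + r%:Z).
  by have := @beads_anti la (k + 1) (content s); rewrite -/a -/b; lia.
suff [c [c1 c2 c3]] : exists c, [/\ k + 1 <= c, c <= k + r%:Z & beads la c = i].
  exists (i, `|(c + i%:Z)%R|%N) => //; have := beads_ge la c.
  rewrite (mem_skew_moves _ kP) /content /=.
  rewrite c3 => cge; have -> : `|(c + i%:Z)%R|%N%:Z - i%:Z = c by lia.
  by rewrite c3 eqxx; lia.
have {le_ia} : (i <= a)%N by lia.
have {le_ba} : exists d : nat, (d < r)%N /\ k + r%:Z = k + 1 + d%:Z.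
  by exists r.-1; lia.
rewrite /a /b in le_bi *; move=> [d [lt_d Ed]]; rewrite {}Ed in le_bi *.
elim: d lt_d le_bi => [|d IH] lt_d le_bi le_ia.
  exists (k + 1); rewrite addr0 in le_bi *.
  by split; lia.
have hS : (beads la (k + 1 + d.+1%:Z)%R <= beads la (k + 1 + d%:Z)%R
           <= (beads la (k + 1 + d.+1%:Z)%R).+1)%N by apply: beadsS; lia.
have [le_i|lt_i] := leqP (beads la (k + 1 + d%:Z)) i.
  by case: IH => // [|c [c1 c2 c3]]; [lia|exists c; split; lia].
by exists (k + 1 + d.+1%:Z); split; lia.
Qed.

(** * Bead-moving operators *)

Section Operators.
Variables (R : comNzRingType) (r : nat) (t : R).
Hypothesis r_gt0 : (0 < r)%N.
Implicit Types (la mu : part) (k c : int) (f : part -> R) (x y : R).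

Definition can_up k la : bool :=
  (beads la k != beads la (k + 1)) && (beads la (k + r%:Z) == beads la (k + r%:Z + 1)).
Definition can_dn k la : bool :=
  (beads la k == beads la (k + 1)) && (beads la (k + r%:Z) != beads la (k + r%:Z + 1)).
Definition up k la : part := xget la [set mu | moves r k la mu].
Definition dn k la : part := xget la [set mu | moves r k mu la].
Definition height k la : nat := (beads la (k + 1)%R - beads la (k + r%:Z)%R)%N.

Lemma moves_can_up k la mu : moves r k la mu -> can_up k la.
Proof. by case/(moves_bead r_gt0) => e1 e2; rewrite /can_up e1 e2 eqxx; lia. Qed.

Lemma moves_can_dn k la mu : moves r k la mu -> can_dn k mu.
Proof.
move=> kP; have [e1 e2] := moves_bead r_gt0 kP; rewrite /can_dn !kP.
rewrite (_ : (k < k <= k + r%:Z) = false); last by lia.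
rewrite (_ : (k < k + 1 <= k + r%:Z) = true); last by lia.
rewrite (_ : (k < k + r%:Z <= k + r%:Z) = true); last by lia.
rewrite (_ : (k < k + r%:Z + 1 <= k + r%:Z) = false); last by lia.
by lia.
Qed.

Lemma moves_inj k la mu mu' : moves r k la mu -> moves r k la mu' -> mu = mu'.
Proof. by move=> h h'; apply: beads_inj => c; rewrite h h'. Qed.

Lemma moves_injl k la la' mu : moves r k la mu -> moves r k la' mu -> la = la'.
Proof. by move=> h h'; apply: beads_inj => c; have := h c; have := h' c; lia. Qed.

Lemma upP k la : can_up k la -> moves r k la (up k la).
Proof.
case/andP => n1 n2; suff [mu muP] : exists mu, moves r k la mu.
  by rewrite /up; case: xgetP => // /(_ mu).
pose M := Order.max (row la 0)%:Z (k + r%:Z + 1).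
pose L := Order.min (- (size la)%:Z) k.
apply: (@part_of_beads _ M L) => [c c' ->|c hc|c hc].
- have := beadsS la (erefl (c + 1)); have := beadsS la (erefl (k + 1)).
  have := beadsS la (erefl (k + r%:Z + 1)).
  have [->|nk] := eqVneq c k.
    rewrite (_ : (k < k <= k + r%:Z) = false); last by lia.
    rewrite (_ : (k < k + 1 <= k + r%:Z) = true); last by lia.
    by move: n1; lia.
  have [->|nkr] := eqVneq c (k + r%:Z).
    rewrite (_ : (k < k + r%:Z <= k + r%:Z) = true); last by lia.
    rewrite (_ : (k < k + r%:Z + 1 <= k + r%:Z) = false); last by lia.
    by move: n2; lia.
  by rewrite (_ : (k < c + 1 <= k + r%:Z) = (k < c <= k + r%:Z)); lia.
- by rewrite beads_hi; move: hc; rewrite /M; lia.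
- by have := @beads_lo la c; move: hc; rewrite /L; lia.
Qed.

Lemma dnP k la : can_dn k la -> moves r k (dn k la) la.
Proof.
case/andP => n1 n2; suff [mu muP] : exists mu, moves r k mu la.
  by rewrite /dn; case: xgetP => // /(_ mu).
(* The bead at [k + r] is counted at every [c] of the interval, so the truncated subtraction below
   is exact. *)
have gt0 c : k < c <= k + r%:Z -> (0 < beads la c)%N.
  move=> hc; have := beadsS la (erefl (k + r%:Z + 1)).
  by have := @beads_anti la c (k + r%:Z); move: n2; lia.
pose M := Order.max (row la 0)%:Z (k + r%:Z + 1).
pose L := Order.min (- (size la)%:Z) k.
have [||| mu muP] :=
    @part_of_beads (fun c => (beads la c - (k < c <= k + r%:Z)%R)%N) M L.
- move=> c c' -> /=.
  have := beadsS la (erefl (c + 1)); have := beadsS la (erefl (k + 1)).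
  have := beadsS la (erefl (k + r%:Z + 1)).
  have [->|nk] := eqVneq c k.
    rewrite (_ : (k < k <= k + r%:Z) = false); last by lia.
    rewrite (_ : (k < k + 1 <= k + r%:Z) = true); last by lia.
    by move: n1; lia.
  have [->|nkr] := eqVneq c (k + r%:Z).
    rewrite (_ : (k < k + r%:Z <= k + r%:Z) = true); last by lia.
    rewrite (_ : (k < k + r%:Z + 1 <= k + r%:Z) = false); last by lia.
    by move: n2; lia.
  rewrite (_ : (k < c + 1 <= k + r%:Z) = (k < c <= k + r%:Z)); last by lia.
  have := gt0 c; have := gt0 (c + 1).
  rewrite (_ : (k < c + 1 <= k + r%:Z) = (k < c <= k + r%:Z)); last by lia.
  by case: (k < c <= k + r%:Z); lia.
- by move=> c hc; rewrite beads_hi; move: hc; rewrite /M; lia.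
- by move=> c hc; have := @beads_lo la c; move: hc; rewrite /L; lia.
by exists mu => c; rewrite muP; have := gt0 c; case: (k < c <= _) => /=; lia.
Qed.

Lemma up_eq k la mu : moves r k la mu -> up k la = mu.
Proof. by move=> h; apply: moves_inj (upP (moves_can_up h)) h. Qed.

Lemma dn_eq k la mu : moves r k la mu -> dn k mu = la.
Proof. by move=> h; apply: moves_injl (dnP (moves_can_dn h)) h. Qed.

(** [f] is evaluated after the move, so in a composite the outermost operator moves first. With [k]
    increasing inwards, [opU] builds a chain with increasing heads, while [opD] dismantles one whose
    heads decrease when it is read upwards. *)
Definition opU x k f : part -> R := fun la =>
  f la + (if can_up k la then x * t ^+ height k la * f (up k la) else 0).
Definition opD y k f : part -> R := fun la =>
  f la + (if can_dn k la then y * t ^+ height k la * f (dn k la) else 0).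

Lemma can_dn_up k la : can_up k la -> can_dn k (up k la).
Proof. by move/upP/moves_can_dn. Qed.

Lemma can_up_dn k la : can_dn k la -> can_up k (dn k la).
Proof. by move/dnP/moves_can_up. Qed.

Lemma dn_upK k la : can_up k la -> dn k (up k la) = la.
Proof. by move/upP/dn_eq. Qed.

Lemma up_dnK k la : can_dn k la -> up k (dn k la) = la.
Proof. by move/dnP/up_eq. Qed.

Lemma height_moves k la mu : moves r k la mu -> height k mu = height k la.
Proof.
move=> kP; rewrite /height !kP.
rewrite (_ : (k < k + 1 <= k + r%:Z) = true); last by lia.
by rewrite (_ : (k < k + r%:Z <= k + r%:Z) = true); lia.
Qed.

(** If [j] and [k] differ by [r], the first move spoils the start or the target of the second, so
    the hypotheses conflict. Otherwise the four positions are distinct. The individual heights may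
    change, but each move alters the height of the other by the same amount. *)
Lemma up_dn_swap j k la : j != k -> can_dn j la -> can_up k (dn j la) ->
  [/\ can_up k la, can_dn j (up k la), up k (dn j la) = dn j (up k la) &
      (height j la + height k (dn j la) = height k la + height j (up k la))%N].
Proof.
move=> njk Dj Uk; have hj := dnP Dj; have hk := upP Uk.
have [Ejk|njkr] := eqVneq j (k + r%:Z).
  move: Uk (hj j) (hj (j + 1)) (beadsS la (erefl (j + 1))).
  rewrite /can_up -Ejk => /andP[_ /eqP->] -> {1}->.
  rewrite (_ : (j < j <= j + r%:Z) = false); last by lia.
  by rewrite (_ : (j < j + 1 <= j + r%:Z) = true); lia.
have [Ekj|nkjr] := eqVneq k (j + r%:Z).
  move: Uk (hj k) (hj (k + 1)) (beadsS la (erefl (k + 1))).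
  have := beadsS (dn j la) (erefl (k + 1)).
  rewrite /can_up => + /andP[n _].
  rewrite (_ : (j < k <= j + r%:Z) = true); last by lia.
  rewrite (_ : (j < k + 1 <= j + r%:Z) = false); last by lia.
  by move: n; lia.
have Uk' : can_up k la.
  move: Uk; rewrite /can_up !hj.
  rewrite (_ : (j < k + 1 <= j + r%:Z) = (j < k <= j + r%:Z)); last by lia.
  rewrite (_ : (j < k + r%:Z + 1 <= j + r%:Z) = (j < k + r%:Z <= j + r%:Z)); last by lia.
  by rewrite !eqn_add2r.
have hk' := upP Uk'.
have Dj' : can_dn j (up k la).
  move: Dj; rewrite /can_dn !hk'.
  rewrite (_ : (k < j + 1 <= k + r%:Z) = (k < j <= k + r%:Z)); last by lia.
  rewrite (_ : (k < j + r%:Z + 1 <= k + r%:Z) = (k < j + r%:Z <= k + r%:Z)); last by lia.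
  by rewrite !eqn_add2r.
have hj' := dnP Dj'; split=> //.
  by apply: beads_inj => c; have := hj c; have := hk c; have := hj' c; have := hk' c; lia.
have /= := (@beads_anti la (j + 1) (j + r%:Z), @beads_anti la (k + 1) (k + r%:Z)).
have /= := (@beads_anti (up k la) (j + 1) (j + r%:Z), @beads_anti (dn j la) (k + 1) (k + r%:Z)).
rewrite /height !hk' => -[a1 a2] [a3 a4].
have := hj (k + 1); have := hj (k + r%:Z).
by lia.
Qed.

Lemma dn_up_swap j k la : j != k -> can_up k la -> can_dn j (up k la) ->
  can_dn j la && can_up k (dn j la).
Proof.
move=> njk Uk Dj; have hk := upP Uk.
have [Ejk|njkr] := eqVneq j (k + r%:Z).
  move: Dj (hk j) (hk (j + 1)) (beadsS la (erefl (j + 1))).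
  rewrite /can_dn => /andP[/eqP n1 _].
  rewrite (_ : (k < j <= k + r%:Z) = true); last by lia.
  by rewrite (_ : (k < j + 1 <= k + r%:Z) = false); lia.
have [Ekj|nkjr] := eqVneq k (j + r%:Z).
  move: Dj (hk k) (hk (k + 1)) (beadsS la (erefl (k + 1))) (beadsS (up k la) (erefl (k + 1))).
  rewrite /can_dn -Ekj => /andP[_ n1].
  rewrite (_ : (k < k <= k + r%:Z) = false); last by lia.
  by rewrite (_ : (k < k + 1 <= k + r%:Z) = true); lia.
have Dj' : can_dn j la.
  move: Dj; rewrite /can_dn !hk.
  rewrite (_ : (k < j + 1 <= k + r%:Z) = (k < j <= k + r%:Z)); last by lia.
  rewrite (_ : (k < j + r%:Z + 1 <= k + r%:Z) = (k < j + r%:Z <= k + r%:Z)); last by lia.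
  by rewrite !eqn_add2r.
rewrite Dj' /=; have hj := dnP Dj'.
move: Uk; rewrite /can_up !hj.
rewrite (_ : (j < k + 1 <= j + r%:Z) = (j < k <= j + r%:Z)); last by lia.
rewrite (_ : (j < k + r%:Z + 1 <= j + r%:Z) = (j < k + r%:Z <= j + r%:Z)); last by lia.
by rewrite !eqn_add2r.
Qed.

Lemma opDU_comm x y j k f : j != k -> opD y j (opU x k f) = opU x k (opD y j f).
Proof.
have aux (a b c d z : R) : a * b = c * d -> y * a * (x * b * z) = x * c * (y * d * z).
  by move=> E; transitivity (x * y * z * (a * b)); [ring|rewrite E; ring].
move=> njk; apply: funext => la; rewrite /opD /opU.
have [Dj|nDj] := boolP (can_dn j la); have [Uk|nUk] := boolP (can_up k la).
- case: ifP => [Uk'|nUk'].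
    have [_ -> -> Eh] := up_dn_swap njk Dj Uk'.
    have : t ^+ height j la * t ^+ height k (dn j la)
         = t ^+ height k la * t ^+ height j (up k la) by rewrite -!exprD Eh.
    by rewrite !mulrDr => /aux->; ring.
  case: ifP => [Dj'|nDj']; last by rewrite !addr0 addrAC.
  by have := dn_up_swap njk Uk Dj'; rewrite nUk' andbF.
- case: ifP => [Uk'|nUk']; last by rewrite !addr0.
  by have [] := up_dn_swap njk Dj Uk'; rewrite (negPf nUk).
- case: ifP => [Dj'|nDj']; last by rewrite !addr0.
  by have := dn_up_swap njk Uk Dj'; rewrite (negPf nDj).
- by rewrite !addr0.
Qed.

(* The index bound is the number of beads on the positions c, .., c + r - 1. *)
Definition phi x y c f : part -> R := fun la =>
  (\prod_(j < (beads la c - beads la (c + r%:Z)%R)%N) (1 + t ^+ (2 * j) * (x * y))) * f la.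

(** With a bead on [k] and none on [k + r], moving out and back contributes [t ^+ (2 * h) * (x * y)]
    on the right, [h] being the height; this supplies the one factor by which the product for [k],
    with [h + 1] factors, exceeds that for [k + 1]. With the bead on [k + r] instead, the sides
    exchange roles. If both positions are free or both occupied, no move is possible and the bounds
    agree. *)
Lemma opDU_diag x y k f :
  phi x y k (opD y k (opU x k f)) = opU x k (opD y k (phi x y (k + 1) f)).
Proof.
apply: funext => la; rewrite /phi /opD /opU.
have Ek1 : k + 1 + r%:Z = k + r%:Z + 1 by lia.
have s1 := beadsS la (erefl (k + 1)); have s2 := beadsS la (erefl (k + r%:Z + 1)).
have le1 : (beads la (k + r%:Z)%R <= beads la (k + 1)%R)%N by apply: beads_anti; lia.
have [Uk|nUk] := boolP (can_up k la); have [Dk|nDk] := boolP (can_dn k la).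
- by move: Uk Dk; rewrite /can_up /can_dn => /andP[+ _] /andP[]; case: eqP.
- have hk := upP Uk; rewrite can_dn_up // dn_upK // (height_moves hk) !Ek1 !hk.
  rewrite (_ : (k < k + 1 <= k + r%:Z) = true); last by lia.
  rewrite (_ : (k < k + r%:Z + 1 <= k + r%:Z) = false); last by lia.
  move: Uk; rewrite /can_up /height => /andP[n1 /eqP n2].
  rewrite -n2 addn0 (_ : beads la k = (beads la (k + 1)%R + 1)%N); last by lia.
  rewrite addnC -addnBA // add1n big_ord_recr /= mul2n -addnn exprD.
  by move: (\prod_(_ < _) _) (t ^+ _) (f _) (f _) => a b c d; ring.
- have hk := dnP Dk; rewrite can_up_dn // up_dnK // !Ek1.
  have hkk := hk (k + 1); have hkr := hk (k + r%:Z + 1); have hkr' := hk (k + r%:Z).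
  move: hkk hkr hkr'.
  rewrite (_ : (k < k + 1 <= k + r%:Z) = true); last by lia.
  rewrite (_ : (k < k + r%:Z + 1 <= k + r%:Z) = false); last by lia.
  rewrite (_ : (k < k + r%:Z <= k + r%:Z) = true); last by lia.
  move=> hkk hkr hkr'; move: (Dk); rewrite /can_dn => /andP[/eqP n1 n2].
  have -> : height k (dn k la) = height k la by rewrite -(height_moves hk).
  have E0 : (beads la k - beads la (k + r%:Z)%R)%N = height k la by rewrite n1.
  have E1 : (beads la (k + 1)%R - beads la (k + r%:Z + 1)%R)%N = (height k la).+1.
    by rewrite /height; lia.
  have E2 : (beads (dn k la) (k + 1)%R - beads (dn k la) (k + r%:Z + 1)%R)%N = height k la.
    by rewrite /height; lia.
  rewrite E0 E1 E2 big_ord_recr /= mul2n -addnn exprD.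
  by move: (\prod_(_ < _) _) (t ^+ _) (f _) (f _) => a b c d; ring.
- rewrite !addr0 Ek1.
  rewrite (_ : (beads la k - beads la (k + r%:Z)%R)%N
             = (beads la (k + 1)%R - beads la (k + r%:Z + 1)%R)%N) //.
  by move: nUk nDk; rewrite /can_up /can_dn; lia.
Qed.

(** * Products over a window of positions *)

Fixpoint stripU x n k f : part -> R :=
  if n is n'.+1 then opU x k (stripU x n' (k + 1) f) else f.
Fixpoint stripD y n k f : part -> R :=
  if n is n'.+1 then opD y k (stripD y n' (k + 1) f) else f.

Lemma stripD_opU_comm x y n k j f : k < j ->
  stripD y n j (opU x k f) = opU x k (stripD y n j f).
Proof.
elim: n j => //= n IH j lt_kj; rewrite IH; last by lia.
by rewrite opDU_comm //; lia.
Qed.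

Lemma opD_stripU_comm x y n k j f : k < j ->
  opD y k (stripU x n j f) = stripU x n j (opD y k f).
Proof.
elim: n j => //= n IH j lt_kj; rewrite -IH; last by lia.
by rewrite opDU_comm //; lia.
Qed.

(** The factor [opU x k] passes all [opD] of larger index, [opDU_diag] replaces the weight for [k]
    by that for [k + 1], and after the induction [opD y k] passes the remaining [opU]. *)
Lemma stripDU x y n k f :
  phi x y k (stripD y n k (stripU x n k f)) =
  stripU x n k (stripD y n k (phi x y (k + n%:Z) f)).
Proof.
elim: n k => [|n IH] k /=; first by rewrite addr0.
rewrite stripD_opU_comm ?opDU_diag ?IH; last by lia.
by rewrite opD_stripU_comm; last lia; congr (opU _ _ (stripU _ _ _ (opD _ _ (stripD _ _ _ (phi _ _ _ _))))); lia.
Qed.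

End Operators.

(** * The commutation relation for several variables *)

Section Cauchy.
Variables (R : comNzRingType) (r : nat) (t : R).
Implicit Types (la mu : part) (k c b M : int) (f g : part -> R) (x y : R).

Local Notation opU := (opU r t).
Local Notation opD := (opD r t).
Local Notation stripU := (stripU r t).
Local Notation stripD := (stripD r t).
Local Notation can_up := (can_up r).
Local Notation can_dn := (can_dn r).
Local Notation up := (up r).
Local Notation dn := (dn r).

(* All positions below [b] are occupied by a bead. *)
Definition full b la : Prop := (beads la b)%:Z = - b.

Lemma full_le b c la : c <= b -> full b la -> (beads la c)%:Z = - c.
Proof.
by rewrite /full => le_cb; have := beads_lip la le_cb; have := beads_ge la c; lia.
Qed.

Lemma full_gt b la k : full b la -> beads la k == beads la (k + 1) -> b <= k.
Proof.
move=> fb e; rewrite leNgt; apply/negP => lt_kb.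
have := @full_le b k la (ltW lt_kb) fb.
by have := @full_le b (k + 1) la _ fb; move: e; lia.
Qed.

Hypothesis r_gt0 : (0 < r)%N.

Lemma full_up b k la : b <= k -> can_up k la -> full b la -> full b (up k la).
Proof.
move=> le_bk /(upP r_gt0) hk; rewrite /full hk.
by rewrite (_ : (k < b <= k + r%:Z) = false) ?addn0; last lia.
Qed.

Lemma full_dn b k la : can_dn k la -> full b la -> full b (dn k la).
Proof.
move=> Dk fb; have /andP[/(full_gt fb) le_bk _] := Dk.
have := dnP r_gt0 Dk b; rewrite (_ : (k < b <= k + r%:Z) = false); last by lia.
by rewrite addn0 /full => <-.
Qed.

(** The first move of a horizontal strip ends on a free position, hence starts at [b - r] or later,
    and all further moves start to its right. So every partition reached is still full below
    [b - r]. *)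
Lemma stripU_local b x n k f g la :
  (forall mu, full (b - r%:Z) mu -> f mu = g mu) -> full b la ->
  stripU x n k f la = stripU x n k g la.
Proof.
move=> eq_fg fb.
have : full (b - r%:Z) la /\ (full b la \/ b - r%:Z <= k).
  by split; [rewrite /full (full_le _ fb)//; lia | left].
elim: n k la {fb} => [|n IH] k la [f1 f2] /=; first exact: eq_fg.
have step mu : full (b - r%:Z) mu -> full b mu \/ b - r%:Z <= k + 1 ->
    stripU x n (k + 1) f mu = stripU x n (k + 1) g mu by move=> *; apply: IH.
rewrite /opU step //; last by case: f2 => [?|?]; [left|right; lia].
case: ifP => // Uk; have le_k : b - r%:Z <= k.
  case: f2 => // fb; have /andP[_ e] := Uk.
  by have := full_gt fb e; lia.
by rewrite step //; [exact: full_up|right; lia].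
Qed.

Lemma stripD_local b y n k f g la :
  (forall mu, full b mu -> f mu = g mu) -> full b la ->
  stripD y n k f la = stripD y n k g la.
Proof.
move=> eq_fg; elim: n k la => [|n IH] k la fb /=; first exact: eq_fg.
by rewrite /opD IH //; case: ifP => // Dk; rewrite IH //; exact: full_dn.
Qed.

Definition supp M f : Prop := forall la, (0 < beads la M)%N -> f la = 0.

Lemma supp_le M M' f : M <= M' -> supp M f -> supp M' f.
Proof. by move=> le_M sf la gt0; apply: sf; apply: leq_trans gt0 (beads_anti _ le_M). Qed.

Lemma supp_stripU M x n k f : supp M f -> supp M (stripU x n k f).
Proof.
move=> sf; elim: n k => [|n IH] k //= la gt0; rewrite /opU IH // add0r.
case: ifP => // Uk; rewrite IH ?mulr0 //.
by rewrite (upP r_gt0 Uk); apply: leq_trans gt0 (leq_addr _ _).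
Qed.

(* Removing ribbons with increasing heads moves a bead at most once: the bead
   that was moved to [p >= M] stays there. *)
Lemma supp_stripD M y n k f : supp M f -> supp (M + r%:Z) (stripD y n k f).
Proof.
(* The bound [p < k + r] keeps the moved bead out of reach: the remaining moves take beads from
   [k + r] or further right. *)
move=> sf la gt0; have {gt0} : (0 < beads la (M + r%:Z)%R)%N \/
  (exists p, [/\ M <= p, p < k + r%:Z & beads la p != beads la (p + 1)]) by left.
elim: n k la => [|n IH] k la Q /=.
  apply: sf; case: Q => [h|[p [h1 _ h3]]].
    by apply: leq_trans h (beads_anti _ _); lia.
  by have := beadsS la (erefl (p + 1)); have := beads_anti la h1; lia.
rewrite /opD IH ?add0r; last first.
  by case: Q => [|[p [h1 h2 h3]]]; [left|right; exists p; split=> //; lia].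
case: ifP => // Dk; rewrite IH ?mulr0 //; have hk := dnP r_gt0 Dk.
have [p_new|old] : (M <= k) \/ (k < M) by lia.
  right; exists k; split=> //; first by lia.
  by have /andP[? _] := can_up_dn r_gt0 Dk.
case: Q => [gt0|[p [h1 h2 h3]]].
  left; move: gt0; rewrite (hk (M + r%:Z)).
  by rewrite (_ : (k < M + r%:Z <= k + r%:Z) = false) ?addn0; last lia.
right; exists p; split=> //; first by lia.
move: h3; rewrite (hk p) (hk (p + 1)).
rewrite (_ : (k < p + 1 <= k + r%:Z) = (k < p <= k + r%:Z)) ?eqn_add2r //.
by lia.
Qed.

Definition kernel x y : R := \prod_(j < r) (1 + t ^+ (2 * j) * (x * y)).

(** The two ends of [stripDU]: on the support of [f] there are no beads from [k + n] on, so the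
    weight there is an empty product, while all [r] positions from [k] on are occupied in [la], so
    the weight on the left is [kernel x y]. *)
Lemma stripUD_comm x y n k f la :
  full (k + r%:Z) la -> supp (k + n%:Z) f ->
  stripU x n k (stripD y n k f) la = kernel x y * stripD y n k (stripU x n k f) la.
Proof.
move=> fk sf.
have E : phi r t x y (k + n%:Z) f = f.
  apply: funext => mu; rewrite /phi.
  have [z|nz] := posnP (beads mu (k + n%:Z)); last by rewrite sf ?mulr0.
  by rewrite z sub0n big_ord0 mul1r.
rewrite -{1}E -(stripDU t r_gt0) /phi; congr (_ * _); rewrite (_ : (_ - _)%N = r) //.
by have := @full_le _ k la _ fk; move: fk; rewrite /full; lia.
Qed.

Lemma stripD_scale y n k f (a : R) :
  stripD y n k (fun la => a * f la) = (fun la => a * stripD y n k f la).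
Proof.
elim: n k => //= n IH k; apply: funext => la; rewrite /opD IH.
by case: ifP => _; rewrite ?addr0 // mulrDr; congr (_ + _); ring.
Qed.

Lemma stripU_scale x n k f (a : R) :
  stripU x n k (fun la => a * f la) = (fun la => a * stripU x n k f la).
Proof.
elim: n k => //= n IH k; apply: funext => la; rewrite /opU IH.
by case: ifP => _; rewrite ?addr0 // mulrDr; congr (_ + _); ring.
Qed.

(** The folds are opposite so that in both cases the head of the list belongs to the strip next to
    the core: outermost for [stripsU] evaluated at the core, innermost for [stripsD] applied to
    [delta] of the core. *)
Definition stripsU n k (xs : seq R) f := foldr (fun x g => stripU x n k g) f xs.
Definition stripsD n k (ys : seq R) f := foldl (fun g y => stripD y n k g) f ys.

Lemma stripsD_local b n k ys f g la :
  (forall mu, full b mu -> f mu = g mu) -> full b la ->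
  stripsD n k ys f la = stripsD n k ys g la.
Proof.
elim: ys f g => [|y ys IH] f g eq_fg fb /=; first exact: eq_fg.
by apply: IH => // mu fmu; apply: stripD_local fmu.
Qed.

Lemma stripsD_scale n k ys f (a : R) :
  stripsD n k ys (fun la => a * f la) = (fun la => a * stripsD n k ys f la).
Proof. by elim: ys f => //= y ys IH f; rewrite stripD_scale IH. Qed.

Lemma supp_stripsU M n k xs f : supp M f -> supp M (stripsU n k xs f).
Proof. by move=> sf; elim: xs => //= x xs IH; apply: supp_stripU. Qed.

(** Each [stripD] applied before the interchange may enlarge the support by [r], hence the margin
    [r * size ys]. *)
Lemma stripU_stripsD n k x ys f la :
  full (k + r%:Z) la -> supp (k + n%:Z - (r * size ys)%:Z) f ->
  stripU x n k (stripsD n k ys f) la =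
  (\prod_(y <- ys) kernel x y) * stripsD n k ys (stripU x n k f) la.
Proof.
elim: ys f => [|y ys IH] f fk sf /=; first by rewrite big_nil mul1r.
rewrite IH //; last first.
  by apply: supp_le (supp_stripD y n k sf); rewrite /=; lia.
rewrite big_cons [kernel x y * _]mulrC -mulrA; congr (_ * _).
transitivity (stripsD n k ys (fun mu => kernel x y * stripD y n k (stripU x n k f) mu) la).
  apply: stripsD_local fk => mu fmu; apply: stripUD_comm => //.
  by apply: supp_le sf; lia.
by rewrite stripsD_scale.
Qed.

Lemma stripsU_stripsD n k xs ys f la :
  full (k + r%:Z + (r * size xs)%:Z) la -> supp (k + n%:Z - (r * size ys)%:Z) f ->
  stripsU n k xs (stripsD n k ys f) la =
  (\prod_(x <- xs) \prod_(y <- ys) kernel x y) * stripsD n k ys (stripsU n k xs f) la.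
Proof.
elim: xs la => [|x xs IH] la fk sf /=; first by rewrite big_nil mul1r.
transitivity (stripU x n k (fun mu => (\prod_(x <- xs) \prod_(y <- ys) kernel x y) *
    stripsD n k ys (stripsU n k xs f) mu) la).
  apply: stripU_local fk => mu fmu; apply: IH => //.
  by rewrite /full (full_le _ fmu) //=; lia.
rewrite stripU_scale stripU_stripsD; last exact: supp_stripsU.
  by rewrite big_cons mulrA [X in X * _ = _]mulrC.
by rewrite /full (full_le _ fk) //=; lia.
Qed.

(** * Evaluation at a core *)

Definition delta mu : part -> R := fun la => (la == mu)%:R.

(** An up move raises some bead count and no later up move lowers it, so nothing but staying put
    leads back to [mu]. *)
Lemma stripsU_delta n k xs mu : stripsU n k xs (delta mu) mu = 1.
Proof.
pose P f := f mu = 1 /\ forall la, (exists c, (beads mu c < beads la c)%N) -> f la = 0.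
suff [] : P (stripsU n k xs (delta mu)) by [].
have Pstep x j f : P f -> P (opU x j f).
  case=> f1 f0; split=> [|la [c hc]]; rewrite /opU.
    rewrite f1; case: ifP => [Uj|_]; last by rewrite addr0.
    rewrite f0 ?mulr0 ?addr0 //; exists (j + 1); rewrite (upP r_gt0 Uj).
    by rewrite (_ : (j < j + 1 <= j + r%:Z) = true) ?addn1; last lia.
  rewrite f0; last by exists c.
  case: ifP => [Uj|_]; rewrite add0r // f0 ?mulr0 //.
  by exists c; rewrite (upP r_gt0 Uj); apply: leq_trans hc (leq_addr _ _).
elim: xs => [|x xs IH] /=.
  split=> [|la [c]]; first by rewrite /delta eqxx.
  by rewrite /delta; case: eqP => // ->; rewrite ltnn.
by elim: n k {IH}(stripsU n k xs _) IH => //= n IH k f Pf; apply: Pstep; exact: IH.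
Qed.

Lemma stripsD_core n k ys f la : (forall j, ~~ can_dn j la) ->
  stripsD n k ys f la = f la.
Proof.
move=> core; elim: ys f => //= y ys IH f; rewrite IH.
by elim: n k {IH} => //= n IHn k; rewrite /opD (negPf (core k)) addr0.
Qed.

(** In the interchanged order the [D] operators come first, and no bead of a core can move back;
    then the [U] operators must return to [ga], which only the trivial moves do. *)
Lemma stripsUD_core n k xs ys ga : (forall j, ~~ can_dn j ga) ->
  full (k + r%:Z + (r * size xs)%:Z) ga ->
  beads ga (k + n%:Z - (r * size ys)%:Z) = 0%N ->
  stripsU n k xs (stripsD n k ys (delta ga)) ga =
  \prod_(x <- xs) \prod_(y <- ys) kernel x y.
Proof.
move=> core fga sga; rewrite stripsU_stripsD //; last first.
  by move=> la; rewrite /delta; case: eqP => // ->; rewrite sga.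
by rewrite stripsD_core // stripsU_delta mulr1.
Qed.

End Cauchy.

(** * Ribbon strips as matrix coefficients *)

Section Strips.
Variables (R : comNzRingType) (r : nat) (t : R).
Hypothesis r_gt0 : (0 < r)%N.
Implicit Types (la mu nu : part) (k b M : int) (c : seq part) (f g : part -> R) (x y : R).

Local Notation stripU := (stripU r t).
Local Notation stripD := (stripD r t).
Local Notation can_up := (can_up r).
Local Notation can_dn := (can_dn r).
Local Notation up := (up r).
Local Notation dn := (dn r).
Local Notation delta := (delta R).

Definition heads la c : seq int := pairmap (fun ka nu => content (ribbon_head ka nu)) la c.
(** A move starting at [p] has its head on [d_(p + r)]; these are the heads of the moves starting at
    [k], .., [k + n - 1]. *)
Definition window k (n : nat) : pred int := fun h => k + r%:Z <= h < k + n%:Z + r%:Z.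

Lemma sub_ribbon la mu d : ribbon r la mu -> (beads la d <= beads mu d)%N.
Proof. by case/ribbonP => k kP; rewrite kP leq_addr. Qed.

Lemma sub_ribbons la c d : path (ribbon r) la c -> (beads la d <= beads (last la c) d)%N.
Proof.
elim: c la => //= mu c IH la /andP[h1 /IH]; apply: leq_trans; exact: sub_ribbon.
Qed.

Lemma ribbons_low la c k n : path (ribbon r) la c -> all (window k n) (heads la c) ->
  beads (last la c) k = beads la k.
Proof.
elim: c la => //= mu c IH la /andP[h1 h2] /andP[hw /(IH _ h2)->].
have /ribbonP[p hp] := h1; move: hw; rewrite (ribbon_headP r_gt0 hp) /window => hw.
by rewrite hp (_ : (p < k <= p + r%:Z) = false) ?addn0; last lia.
Qed.

(** All partitions of the chain lie below the last one, hence are full below [k + r] too. Every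
    target of a move is free, so at least [k + r], and it is less than [k + n + r], beyond which the
    last partition has no beads. *)
Lemma heads_window la c k n : path (ribbon r) la c -> full (k + r%:Z) (last la c) ->
  beads (last la c) (k + n%:Z + r%:Z) = 0%N -> all (window k n) (heads la c).
Proof.
elim: c la => //= mu c IH la /andP[h1 h2] fk z; rewrite IH // andbT.
have /ribbonP[p hp] := h1; rewrite (ribbon_headP r_gt0 hp) /window.
have fl : full (k + r%:Z) la.
  have := sub_ribbon (k + r%:Z) h1; have := sub_ribbons (k + r%:Z) h2.
  by have := beads_ge la (k + r%:Z); move: fk; rewrite /full; lia.
have /andP[_ /(full_gt fl) le_k] := moves_can_up r_gt0 hp; apply/andP; split=> //.
rewrite ltNge; apply/negP => /(beads_anti mu).
have := sub_ribbons (k + n%:Z + r%:Z) h2; rewrite z (hp (p + r%:Z)).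
by rewrite (_ : (p < p + r%:Z <= p + r%:Z) = true); lia.
Qed.

Lemma stripU_low x n k d mu la : d <= k -> beads la d != beads mu d ->
  stripU x n k (delta mu) la = 0.
Proof.
elim: n k la => [|n IH] k la le_d neq /=.
  by rewrite /delta (_ : (la == mu) = false) //; apply: contraNF neq => /eqP->.
rewrite /opU IH ?add0r //; last by lia.
case: ifP => // Uk; rewrite IH ?mulr0 //; first by lia.
by rewrite (upP r_gt0 Uk) (_ : (k < d <= k + r%:Z) = false) ?addn0; last lia.
Qed.

Lemma stripD_low x n k d mu la : d <= k -> beads la d != beads mu d ->
  stripD x n k (delta mu) la = 0.
Proof.
elim: n k la => [|n IH] k la le_d neq /=.
  by rewrite /delta (_ : (la == mu) = false) //; apply: contraNF neq => /eqP->.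
rewrite /opD IH ?add0r //; last by lia.
case: ifP => // Dk; rewrite IH ?mulr0 //; first by lia.
move: neq; rewrite (dnP r_gt0 Dk).
by rewrite (_ : (k < d <= k + r%:Z) = false) ?addn0; last lia.
Qed.

Definition spin2 la c : nat := sumn (pairmap ribbon_height la c).

(** At each [k] just one branch of [opU] survives: whether the bead moves is visible in the count at
    [k + 1], which moves of larger index do not change ([stripU_low]). Increasing heads make a move
    from [k] the first of the chain. *)
Lemma stripU_chain x n k la c : path (ribbon r) la c ->
  pairwise <%R (heads la c) -> all (window k n) (heads la c) ->
  stripU x n k (delta (last la c)) la = x ^+ size c * t ^+ spin2 la c.
Proof.
elim: n k la c => [|n IH] k la c pc srt hw.
  case: c pc hw {srt} => [|mu c] _ /=; first by rewrite /delta eqxx !expr0 mulr1.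
  by rewrite /window; lia.
have [hw1|] := boolP (all (window (k + 1) n) (heads la c)).
  rewrite /= /opU IH //; case: ifP => [Uk|_]; last by rewrite addr0.
  rewrite (@stripU_low _ _ _ (k + 1)) ?mulr0 ?addr0 //.
  rewrite (ribbons_low pc hw1) (upP r_gt0 Uk).
  by rewrite (_ : (k < k + 1 <= k + r%:Z) = true); lia.
case: c pc srt hw => //= mu c /andP[h1 h2] /andP[h3 h4] /andP[h5 h6] h7.
have /ribbonP[p hp] := h1; move: h3 h5 h7; rewrite (ribbon_headP r_gt0 hp) => h3 h5 h7.
have hw1 : all (window (k + 1) n) (heads mu c).
  apply/allP => h hin; have := allP h3 _ hin; have := allP h6 _ hin.
  by move: h5; rewrite /window; lia.
have Epk : p = k by move: h5 h7; rewrite hw1 andbT /window; lia.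
rewrite {}Epk in hp; rewrite /opU (moves_can_up r_gt0 hp) (up_eq r_gt0 hp) IH //.
rewrite (@stripU_low _ _ _ (k + 1)) //; last first.
  have := sub_ribbons (k + 1) h2; rewrite (hp (k + 1)).
  by rewrite (_ : (k < k + 1 <= k + r%:Z) = true); lia.
by rewrite add0r /spin2 /= (ribbon_heightP r_gt0 hp) exprS exprD -/(height r k la); ring.
Qed.

Lemma heads_rcons la c mu :
  heads la (rcons c mu) = rcons (heads la c) (content (ribbon_head (last la c) mu)).
Proof. by rewrite /heads -!cats1 pairmap_cat. Qed.

Lemma spin2_rcons la c mu :
  spin2 la (rcons c mu) = (spin2 la c + ribbon_height (last la c) mu)%N.
Proof. by rewrite /spin2 -!cats1 pairmap_cat sumn_cat /= addn0. Qed.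

(** As for [stripU_chain], but heads now decrease, so a move at [k] belongs to the last ribbon and
    the chain is taken apart from its end. *)
Lemma stripD_chain x n k la c : path (ribbon r) la c ->
  pairwise >%R (heads la c) -> all (window k n) (heads la c) ->
  stripD x n k (delta la) (last la c) = x ^+ size c * t ^+ spin2 la c.
Proof.
elim: n k c => [|n IH] k c pc srt hw.
  case: c pc hw {srt} => [|mu c] _ /=; first by rewrite /delta eqxx !expr0 mulr1.
  by rewrite /window; lia.
have [hw1|] := boolP (all (window (k + 1) n) (heads la c)).
  rewrite /= /opD IH //; case: ifP => [Dk|_]; last by rewrite addr0.
  rewrite (@stripD_low _ _ _ (k + 1)) ?mulr0 ?addr0 //.
  rewrite -(ribbons_low pc hw1) (dnP r_gt0 Dk (k + 1)).
  by rewrite (_ : (k < k + 1 <= k + r%:Z) = true); lia.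
elim/last_ind: c pc srt hw => // c mu _; rewrite rcons_path heads_rcons last_rcons.
rewrite pairwise_rcons !all_rcons => /andP[h2 h1] /andP[h3 h4] /andP[h5 h6] h7.
have /ribbonP[p hp] := h1; move: h3 h5 h7; rewrite (ribbon_headP r_gt0 hp) => h3 h5 h7.
have hw1 : all (window (k + 1) n) (heads la c).
  apply/allP => h hin; have := allP h3 _ hin; have := allP h6 _ hin.
  by move: h5; rewrite /window; lia.
have Epk : p = k by move: h5 h7; rewrite hw1 andbT /window; lia.
rewrite {}Epk in hp; rewrite /= /opD (moves_can_dn r_gt0 hp) (dn_eq r_gt0 hp) IH //.
rewrite (@stripD_low _ _ _ (k + 1)) //; last first.
  have := sub_ribbons (k + 1) h2; rewrite (hp (k + 1)).
  by rewrite (_ : (k < k + 1 <= k + r%:Z) = true); lia.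
rewrite add0r spin2_rcons size_rcons (ribbon_heightP r_gt0 hp) exprS exprD.
by rewrite (height_moves r_gt0 hp) -/(height r k (last la c)); ring.
Qed.

Lemma stripU_exists x n k la mu : stripU x n k (delta mu) la != 0 ->
  exists c, [/\ path (ribbon r) la c, last la c = mu, pairwise <%R (heads la c) &
                all (window k n) (heads la c)].
Proof.
elim: n k la => [|n IH] k la /=.
  rewrite /delta; have [-> _|_] := eqVneq la mu; last by rewrite eqxx.
  by exists [::].
have [z|/IH[c [h1 h2 h3 h4]] _] := eqVneq (stripU x n (k + 1) (delta mu) la) 0; last first.
  by exists c; split=> //; apply: sub_all h4 => h; rewrite /window; lia.
rewrite /opU z add0r; case: ifP => [Uk nz|]; last by rewrite eqxx.
have [c [h1 h2 h3 h4]] : exists c,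
    [/\ path (ribbon r) (up k la) c, last (up k la) c = mu,
        pairwise <%R (heads (up k la) c) & all (window (k + 1) n) (heads (up k la) c)].
  by apply: IH; apply: contraNneq nz => ->; rewrite mulr0.
have hk := upP r_gt0 Uk; exists (up k la :: c) => /=.
rewrite h1 h3 h2 (ribbon_headP r_gt0 hk) !andbT; split=> //.
- by apply/ribbonP; exists k.
- by apply: sub_all h4 => h; rewrite /window; lia.
- apply/andP; split; first by rewrite /window; lia.
  by apply: sub_all h4 => h; rewrite /window; lia.
Qed.

Lemma stripD_exists x n k la mu : stripD x n k (delta la) mu != 0 ->
  exists c, [/\ path (ribbon r) la c, last la c = mu, pairwise >%R (heads la c) &
                all (window k n) (heads la c)].
Proof.
elim: n k mu => [|n IH] k mu /=.
  rewrite /delta; have [-> _|_] := eqVneq mu la; last by rewrite eqxx.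
  by exists [::].
have [z|/IH[c [h1 h2 h3 h4]] _] := eqVneq (stripD x n (k + 1) (delta la) mu) 0; last first.
  by exists c; split=> //; apply: sub_all h4 => h; rewrite /window; lia.
rewrite /opD z add0r; case: ifP => [Dk nz|]; last by rewrite eqxx.
have [c [h1 h2 h3 h4]] : exists c,
    [/\ path (ribbon r) la c, last la c = dn k mu,
        pairwise >%R (heads la c) & all (window (k + 1) n) (heads la c)].
  by apply: IH; apply: contraNneq nz => ->; rewrite mulr0.
have hk := dnP r_gt0 Dk; exists (rcons c mu).
rewrite heads_rcons last_rcons rcons_path pairwise_rcons all_rcons h1 h3 h2.
rewrite (ribbon_headP r_gt0 hk) !andbT /=; split=> //.
- by apply/ribbonP; exists k.
- by apply: sub_all h4 => h; rewrite /window; lia.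
- apply/andP; split; first by rewrite /window; lia.
  by apply: sub_all h4 => h; rewrite /window; lia.
Qed.

Definition strip_weight (ord : rel int) x la mu : R :=
  if strip ord r la mu
  then x ^+ strip_size ord r la mu * t ^+ strip_spin2 ord r la mu else 0.

Lemma standardisationP (ord : rel int) la mu : transitive ord -> strip ord r la mu ->
  let c := standardisation ord r la mu in
  [/\ path (ribbon r) la c, last la c = mu & pairwise ord (heads la c)].
Proof.
move=> ord_tr /asboolP[c0 c0P] c; rewrite -sorted_pairwise //.
by rewrite /c /standardisation; case: xgetP => [c' _ //|/(_ c0)].
Qed.

Lemma stripU_delta x n k la mu : full (k + r%:Z) mu ->
  beads mu (k + n%:Z + r%:Z) = 0%N ->
  stripU x n k (delta mu) la = strip_weight <%R x la mu.
Proof.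
move=> fk z; rewrite /strip_weight; case: ifPn => [|ns].
  move/(standardisationP lt_trans) => [h1 h2 h3].
  rewrite -{1}h2 stripU_chain // heads_window ?h2 //.
apply: contraNeq ns => /stripU_exists[c [h1 h2 h3 _]].
by apply/asboolP; exists c; split=> //; rewrite sorted_pairwise //; exact: lt_trans.
Qed.

Lemma gt_trans : transitive (>%R : rel int).
Proof. by move=> a b c h1 h2; apply: lt_trans h2 h1. Qed.

Lemma stripD_delta x n k la mu : full (k + r%:Z) mu ->
  beads mu (k + n%:Z + r%:Z) = 0%N ->
  stripD x n k (delta la) mu = strip_weight >%R x la mu.
Proof.
move=> fk z; rewrite /strip_weight; case: ifPn => [|ns].
  move/(standardisationP gt_trans) => [h1 h2 h3].
  rewrite -{1}h2 stripD_chain // heads_window ?h2 //.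
apply: contraNeq ns => /stripD_exists[c [h1 h2 h3 _]].
by apply/asboolP; exists c; split=> //; rewrite sorted_pairwise //; exact: gt_trans.
Qed.

End Strips.

Lemma window_exists (r : nat) (mu : part) : exists (k : int) (n : nat),
  full (k + r%:Z) mu /\ beads mu (k + n%:Z + r%:Z) = 0%N.
Proof.
exists (- (size mu)%:Z - r%:Z), (size mu + row mu 0)%N; split.
  by rewrite /full beads_lo; lia.
by rewrite beads_hi //; lia.
Qed.

(** Read off from the operators over [int] with all weights 1: the coefficient of a strip is then 1,
    whereas by [stripU_local] it would be 0 if [mu] were not full below [b - r]. *)
Lemma full_hstrip (r : nat) (la mu : part) (b : int) : (0 < r)%N ->
  strip <%R r la mu -> full b la -> full (b - r%:Z) mu.
Proof.
move=> r_gt0 st fb; have [k [n [fk z]]] := window_exists r mu.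
apply: contrapT => nf; have := @stripU_delta int r 1 r_gt0 1 n k la mu fk z.
(* The zero function is written as a multiple of 0, so that [stripU_scale] evaluates it. *)
rewrite (@stripU_local _ _ _ r_gt0 b _ _ _ _ (fun=> 0 * 0)) //; last first.
  by move=> nu fnu; rewrite /delta mulr0; case: eqP => // E; rewrite E in fnu.
by rewrite stripU_scale mul0r /strip_weight st !expr1n.
Qed.

(** The same device: the coefficient 1 of a strip contradicts the bound of [supp_stripD] on the
    support. *)
Lemma beads_vstrip (r : nat) (la mu : part) (M : int) : (0 < r)%N ->
  strip >%R r la mu -> beads la M = 0%N -> beads mu (M + r%:Z) = 0%N.
Proof.
move=> r_gt0 st z0; have [k [n [fk z]]] := window_exists r mu.
have sd : supp M (delta int la) by move=> nu; rewrite /delta; case: eqP => // ->; rewrite z0.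
have := @stripD_delta int r 1 r_gt0 1 n k la mu fk z.
have [//|nz] := posnP (beads mu (M + r%:Z)).
by rewrite (@supp_stripD int r 1 r_gt0 M 1 n k _ sd) // /strip_weight st !expr1n.
Qed.

(** * Sums over chains of strips *)

Lemma finite_bounded_seq (T : choiceType) (A : set T) (n : nat) : finite_set A ->
  finite_set [set c : seq T | (size c <= n)%N /\ (forall x, x \in c -> A x)].
Proof.
move=> finA; elim: n => [|n IH].
  by apply: sub_finite_set (finite_set1 [::]) => -[] // x c [].
have fin := finite_image2 cons finA IH.
apply: (@sub_finite_set _ _ ([set [::]] `|` [set x :: y | x in A & y in
    [set c : seq T | (size c <= n)%N /\ (forall x, x \in c -> A x)]])%classic).
  move=> [|x c] [sz Ac]; [by left|right; exists x].
    by apply: Ac; rewrite mem_head.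
  by exists c => //; split=> // y yc; apply: Ac; rewrite inE yc orbT.
by rewrite finite_setU; split=> //; exact: finite_set1.
Qed.

Definition box (b M : int) : set part := [set la | full b la /\ beads la M = 0%N].

Lemma finite_box (b M : int) : finite_set (box b M).
Proof.
have := @finite_bounded_seq nat `I_(`|M|.+1) `|b| (finite_II _).
move=> /(@finite_preimage part _ _ parts (in2W val_inj)).
apply: sub_finite_set => la [fb z] /=.
have sz : (size la <= `|b|)%N.
  have := ltn_beads la b `|b|; have := row_gt0 la `|b|.
  by move: fb; rewrite /full; lia.
split=> // x /(nthP 0%N)[i _ <-]; rewrite -/(row la i).
have := leq_row la (leq0n i); have := ltn_beads la M 0.
by rewrite z; lia.
Qed.

(** Tableaux in [N] variables will be represented by chains of exactly [N] partitions, padded by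
    repetitions, so that their sums run over a fixed finite list. *)
Fixpoint words (T : Type) (B : seq T) (n : nat) : seq (seq T) :=
  if n is n'.+1 then [seq x :: c | x <- B, c <- words B n'] else [:: [::]].

Lemma mem_words (T : eqType) (B : seq T) n c :
  (c \in words B n) = (size c == n) && all [in B] c.
Proof.
elim: n c => [|n IH] [|x c] //=; first by apply/negP => /allpairsP[[y d] []].
apply/allpairsP/idP => [[[y d] /= [h1 + [-> ->]]]|].
  by rewrite IH eqSS h1.
rewrite eqSS => /and3P[h1 h2 h3]; exists (x, c); split=> //=.
by rewrite IH h1.
Qed.

Lemma uniq_words (T : eqType) (B : seq T) n : uniq B -> uniq (words B n).
Proof.
move=> uB; elim: n => //= n IH; apply: allpairs_uniq => // -[x c] [y d] _ _ /= [-> ->] //.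
Qed.

Lemma big_words_cons (R : nmodType) (T : eqType) (B : seq T) n (F : seq T -> R) :
  \sum_(c <- words B n.+1) F c = \sum_(x <- B) \sum_(c <- words B n) F (x :: c).
Proof. exact: big_allpairs_dep. Qed.

Lemma big_words_rcons (R : nmodType) (T : eqType) (B : seq T) n (F : seq T -> R) :
  \sum_(c <- words B n.+1) F c = \sum_(c <- words B n) \sum_(x <- B) F (rcons c x).
Proof.
elim: n F => [|n IH] F.
  by rewrite big_words_cons big_seq1; apply: eq_bigr => x _; rewrite big_seq1.
by rewrite big_words_cons [RHS]big_words_cons; apply: eq_bigr => x _; rewrite IH.
Qed.

Section ChainSums.
Variables (R : comNzRingType) (r : nat) (t : R).
Hypothesis r_gt0 : (0 < r)%N.
Implicit Types (la mu nu ga : part) (c : seq part) (f g : part -> R) (x y : R).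

Local Notation stripU := (stripU r t).
Local Notation stripD := (stripD r t).
Local Notation stripsU := (stripsU r t).
Local Notation stripsD := (stripsD r t).
Local Notation delta := (delta R).

Definition chain_weight (ord : rel int) (Z : nat -> R) ga c : R :=
  \prod_(j < size c) strip_weight r t ord (Z j) (nth ga (ga :: c) j) (nth ga c j).

Lemma chain_weight_cons ord Z ga mu c :
  chain_weight ord Z ga (mu :: c) =
  strip_weight r t ord (Z 0%N) ga mu * chain_weight ord (fun j => Z j.+1) mu c.
Proof.
rewrite /chain_weight (big_ord_recl (size c)); congr (_ * _); apply: eq_bigr => j _.
by rewrite lift0 /=; congr (strip_weight _ _ _ _ _ _); apply: set_nth_default => //; exact: (ltnW (ltn_ord j)).
Qed.

Lemma chain_weight_rcons ord Z ga mu c :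
  chain_weight ord Z ga (rcons c mu) =
  chain_weight ord Z ga c * strip_weight r t ord (Z (size c)) (last ga c) mu.
Proof.
rewrite /chain_weight size_rcons big_ord_recr /= nth_rcons ltnn eqxx; congr (_ * _).
  apply: eq_bigr => j _; rewrite nth_rcons ltn_ord -rcons_cons nth_rcons /=.
  by rewrite ltnS (ltnW (ltn_ord j)).
by rewrite -rcons_cons nth_rcons /= ltnSn -last_nth.
Qed.

Variables (k : int) (n : nat).
Let B : seq part := fset_set (box (k + r%:Z) (k + n%:Z + r%:Z)).

Lemma mem_B la : reflect (full (k + r%:Z) la /\ beads la (k + n%:Z + r%:Z) = 0%N) (la \in B).
Proof.
rewrite /B in_fset_set; last exact: finite_box.
by apply: (iffP idP); rewrite inE.
Qed.

Lemma uniq_B : uniq B.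
Proof. exact: fset_uniq. Qed.

Lemma down_B la mu : (forall d, beads la d <= beads mu d)%N -> mu \in B -> la \in B.
Proof.
move=> le /mem_B[fb z]; apply/mem_B; split.
  by have := le (k + r%:Z); have := beads_ge la (k + r%:Z); move: fb; rewrite /full; lia.
by have := le (k + n%:Z + r%:Z); lia.
Qed.

Lemma stripU_sum x m j (s : seq part) (F : part -> part -> R) la :
  stripU x m j (fun mu => \sum_(nu <- s) F nu mu) la = \sum_(nu <- s) stripU x m j (F nu) la.
Proof.
elim: m j la => //= m IH j la; rewrite /opU !IH; case: ifP => _.
  by rewrite mulr_sumr -big_split.
by rewrite addr0; apply: eq_bigr => nu _; rewrite addr0.
Qed.

Lemma stripD_sum x m j (s : seq part) (F : part -> part -> R) la :
  stripD x m j (fun mu => \sum_(nu <- s) F nu mu) la = \sum_(nu <- s) stripD x m j (F nu) la.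
Proof.
elim: m j la => //= m IH j la; rewrite /opD !IH; case: ifP => _.
  by rewrite mulr_sumr -big_split.
by rewrite addr0; apply: eq_bigr => nu _; rewrite addr0.
Qed.

Lemma delta_expand f la : \sum_(nu <- B) f nu * delta nu la = if la \in B then f la else 0.
Proof.
case: ifPn => inB.
  rewrite (bigD1_seq la) ?uniq_B //= /delta eqxx mulr1 big1 ?addr0 // => nu ne.
  by rewrite eq_sym (negPf ne) mulr0.
rewrite big_seq big1 // => nu nuB; rewrite /delta; case: eqP => [E|_]; last by rewrite mulr0.
by rewrite E nuB in inB.
Qed.

(** Up moves can leave the box [B], so [f] has to vanish outside it for the expansion in the
    functions [delta nu] to be complete. *)
Lemma stripU_expand x f la : (forall mu, mu \notin B -> f mu = 0) ->
  stripU x n k f la = \sum_(nu <- B) strip_weight r t <%R x la nu * f nu.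
Proof.
move=> f0; have -> : f = (fun mu => \sum_(nu <- B) f nu * delta nu mu).
  by apply: funext => mu; rewrite delta_expand; case: ifPn => // /f0.
rewrite stripU_sum -/B; apply: eq_big_seq => nu nuB.
rewrite stripU_scale delta_expand nuB mulrC.
by have /mem_B[h1 h2] := nuB; rewrite stripU_delta.
Qed.

Lemma stripD_eq_in x m j f g la : (forall mu, mu \in B -> f mu = g mu) -> la \in B ->
  stripD x m j f la = stripD x m j g la.
Proof.
move=> eq_fg; elim: m j la => [|m IH] j la laB /=; first exact: eq_fg.
rewrite /opD IH //; case: ifP => // Dj; rewrite IH //; apply: down_B laB => d.
by rewrite (dnP r_gt0 Dj d) leq_addr.
Qed.

(** Down moves from [la] never leave the box, so here it is [la] that is confined to [B], and [f] is
    arbitrary. *)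
Lemma stripD_expand x f la : la \in B ->
  stripD x n k f la = \sum_(nu <- B) strip_weight r t >%R x nu la * f nu.
Proof.
move=> laB; rewrite (@stripD_eq_in _ _ _ _ (fun mu => \sum_(nu <- B) f nu * delta nu mu)) //.
  rewrite stripD_sum; apply: eq_bigr => nu _; rewrite stripD_scale mulrC.
  by have /mem_B[h1 h2] := laB; rewrite stripD_delta.
by move=> mu muB; rewrite delta_expand muB.
Qed.

Lemma stripU_outside x m j f : (forall mu, mu \notin B -> f mu = 0) ->
  forall mu, mu \notin B -> stripU x m j f mu = 0.
Proof.
move=> f0; elim: m j => //= m IH j mu muB; rewrite /opU IH // add0r.
case: ifP => // Uj; rewrite IH ?mulr0 //; apply: contra muB; apply: down_B => d.
by rewrite (upP r_gt0 Uj) leq_addr.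
Qed.

Lemma stripsU_sum xs (s : seq part) (F : part -> part -> R) la :
  stripsU n k xs (fun mu => \sum_(nu <- s) F nu mu) la =
  \sum_(nu <- s) stripsU n k xs (F nu) la.
Proof.
elim: xs la => //= x xs IH la; rewrite -stripU_sum; congr stripU.
exact: funext.
Qed.

Lemma stripsU_scale xs f (a : R) la :
  stripsU n k xs (fun mu => a * f mu) la = a * stripsU n k xs f la.
Proof.
elim: xs la => //= x xs IH la; rewrite -[RHS]/((fun mu => a * _ mu) la) -stripU_scale.
congr stripU; exact: funext.
Qed.

Lemma stripsU_local b xs f g la : (forall mu, full b mu -> f mu = g mu) ->
  full (b + (r * size xs)%:Z) la -> stripsU n k xs f la = stripsU n k xs g la.
Proof.
move=> eq_fg; elim: xs la => [|x xs IH] la /= fla.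
  by apply: eq_fg; rewrite /full (full_le _ fla) //; lia.
apply: (@stripU_local _ _ _ r_gt0 (b + (r * size xs)%:Z + r%:Z)) => [mu fmu|].
  by apply: IH; rewrite /full (full_le _ fmu) //; lia.
by rewrite /full (full_le _ fla) //; lia.
Qed.

Lemma supp_stripsD M ys f : supp M f -> supp (M + (r * size ys)%:Z) (stripsD n k ys f).
Proof.
elim: ys M f => [|y ys IH] M f sf /=; first by rewrite muln0 addr0.
have := IH _ _ (supp_stripD t r_gt0 y n k sf).
by apply: supp_le; lia.
Qed.

Lemma stripsU_chains (X : nat -> R) N la mu : mu \in B ->
  stripsU n k (mkseq X N) (delta mu) la =
  \sum_(c <- words B N) if last la c == mu then chain_weight <%R X la c else 0.
Proof.
move=> muB; elim: N X la => [|N IH] X la.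
  by rewrite big_seq1 /= /delta /chain_weight big_ord0; case: eqP.
rewrite big_words_cons /mkseq /= -[1%N]addn0 iotaDl -map_comp stripU_expand; last first.
  elim: (map _ _) => [|x xs IHxs] /=; last exact: stripU_outside.
  by move=> nu nuB; rewrite /delta; case: eqP nuB => // ->; rewrite muB.
apply: eq_bigr => nu _.
rewrite -[map _ _]/(mkseq (fun j => X j.+1) N) IH mulr_sumr; apply: eq_bigr => c _ /=.
by rewrite chain_weight_cons; case: ifP => //; rewrite mulr0.
Qed.

Lemma stripsD_chains (Y : nat -> R) N ga la : ga \in B -> la \in B ->
  stripsD n k (mkseq Y N) (delta ga) la =
  \sum_(c <- words B N) if last ga c == la then chain_weight >%R Y ga c else 0.
Proof.
move=> gaB; elim: N la => [|N IH] la laB.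
  rewrite big_seq1 /= /delta /chain_weight big_ord0.
  by rewrite eq_sym; case: eqP.
rewrite mkseqS /stripsD foldl_rcons -/(stripsD _ _ _ _) stripD_expand //.
rewrite big_words_rcons.
under eq_big_seq => nu nuB do rewrite IH // mulr_sumr.
rewrite exchange_big; apply: eq_big_seq => c; rewrite mem_words => /andP[/eqP sz cB].
have lastB : last ga c \in B.
  by have := mem_last ga c; rewrite inE => /predU1P[->//|/(allP cB)].
rewrite [RHS](bigD1_seq la) ?uniq_B //= last_rcons eqxx [X in _ + X]big1; last first.
  by move=> mu /negPf ne; rewrite last_rcons ne.
rewrite (bigD1_seq (last ga c)) ?uniq_B //= eqxx [X in _ + X]big1; last first.
  by move=> mu ne; rewrite eq_sym (negPf ne) mulr0.
by rewrite !addr0 chain_weight_rcons sz mulrC.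
Qed.

Lemma chain_sum_cauchy (X Y : nat -> R) N ga :
  (forall j, ~~ can_dn r j ga) -> full (k + r%:Z + (r * N)%:Z) ga ->
  beads ga (k + n%:Z - (r * N)%:Z) = 0%N ->
  \sum_(la <- B)
    (\sum_(c <- words B N) if last ga c == la then chain_weight <%R X ga c else 0) *
    (\sum_(c <- words B N) if last ga c == la then chain_weight >%R Y ga c else 0) =
  \prod_(i < N) \prod_(j < N) kernel r t (X i) (Y j).
Proof.
move=> core fga sga.
have gaB : ga \in B.
  apply/mem_B; split; first by rewrite /full (full_le _ fga) //; lia.
  apply/eqP; rewrite -leqn0 -sga; apply: beads_anti; lia.
have := @stripsUD_core R r t r_gt0 n k (mkseq X N) (mkseq Y N) ga core.
rewrite !size_mkseq => /(_ fga sga).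
have big_mkseq (Z : nat -> R) (F : R -> R) : \prod_(z <- mkseq Z N) F z = \prod_(i < N) F (Z i).
  by rewrite big_map -[N in iota 0 N]subn0 -/(index_iota 0 N) big_mkord.
under eq_bigr => x _ do rewrite big_mkseq; rewrite big_mkseq => <-.
set g := stripsD n k _ _.
(* The identity is inserted between the [U] and the [D] operators as a sum over [B]; the [U]
   operators only see partitions that are full below [k + r]. *)
rewrite (@stripsU_local (k + r%:Z) _ g (fun mu => \sum_(nu <- B) g nu * delta nu mu)).
- rewrite stripsU_sum; apply: eq_big_seq => la laB.
  by rewrite stripsU_scale mulrC stripsU_chains // -stripsD_chains.
(* A full partition outside [B] has a bead beyond the right end, where [g] vanishes by the bound on
   its support. *)
- move=> mu fmu; rewrite delta_expand; case: ifPn => // /mem_B nB.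
  have sg : supp (k + n%:Z - (r * N)%:Z + (r * N)%:Z) g.
    rewrite -{2}(size_mkseq Y N); apply: supp_stripsD => nu.
    by rewrite /delta; case: eqP => // ->; rewrite sga.
  apply: sg; rewrite subrK lt0n; apply: contra_notN nB => /eqP z; split=> //.
  by apply/eqP; rewrite -leqn0 -z; apply: beads_anti; lia.
- by rewrite size_mkseq.
Qed.

End ChainSums.

(** * Generating series of tableaux *)

Lemma sub_strip (ord : rel int) (r : nat) (la mu : part) (d : int) :
  strip ord r la mu -> (beads la d <= beads mu d)%N.
Proof. by case/asboolP=> c [pc <- _]; exact: sub_ribbons pc. Qed.

Lemma sub_strips (ord : rel int) (r : nat) (ga : part) (P : seq part) (d : int) :
  path (strip ord r) ga P -> (beads ga d <= beads (last ga P) d)%N.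
Proof.
elim: P ga => //= mu P IH ga /andP[st /IH]; apply: leq_trans; exact: sub_strip st.
Qed.

Lemma sub_strips_mem (ord : rel int) (r : nat) (ga : part) (P : seq part) (d : int) :
  path (strip ord r) ga P -> {in P, forall nu, beads nu d <= beads (last ga P) d}%N.
Proof.
elim: P ga => //= mu P IH ga /andP[_ pP] nu; rewrite inE => /predU1P[->|/(IH _ pP)//].
exact: sub_strips pP.
Qed.

Lemma ribbon_le_strips (ord : rel int) (r : nat) (ga : part) (P : seq part) :
  path (strip ord r) ga P -> ribbon_le r ga (last ga P).
Proof.
elim: P ga => [|mu P IH] ga /=; first by exists [::].
move=> /andP[/asboolP[c [pc lc _]] /IH[c' [pc' lc']]]; exists (c ++ c').
by rewrite cat_path last_cat lc pc pc'.
Qed.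

Lemma ribbons_loop (r : nat) (la : part) (c : seq part) : (0 < r)%N ->
  path (ribbon r) la c -> last la c = la -> c = [::].
Proof.
move=> r_gt0; case: c => //= mu c /andP[/ribbonP[p hp] pc] lc.
have := sub_ribbons (p + 1) pc; rewrite lc (hp (p + 1)).
by rewrite (_ : (p < p + 1 <= p + r%:Z) = true); lia.
Qed.

Lemma strip_refl (ord : rel int) (r : nat) (la : part) : strip ord r la la.
Proof. by apply/asboolP; exists [::]. Qed.

Lemma strip_sizeP (ord : rel int) (r : nat) (la mu : part) : transitive ord ->
  strip ord r la mu -> strip_size ord r la mu = 0%N -> la = mu.
Proof.
move=> ord_tr /(standardisationP ord_tr)[_ + _] /size0nil.
by rewrite /standardisation => + E; rewrite E.
Qed.

Lemma strip_weight_refl (R : comNzRingType) (r : nat) (t : R) (ord : rel int) (x : R) (la : part) :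
  (0 < r)%N -> transitive ord -> strip_weight r t ord x la la = 1.
Proof.
move=> r_gt0 ord_tr; rewrite /strip_weight strip_refl /strip_size /strip_spin2.
have [pc lc _] := standardisationP ord_tr (strip_refl ord r la).
by rewrite (ribbons_loop r_gt0 pc lc) /= !expr0 mulr1.
Qed.

Lemma chain_weight_npath (R : comNzRingType) (r : nat) (t : R) (ord : rel int)
    (Z : nat -> R) (ga : part) (c : seq part) :
  ~~ path (strip ord r) ga c -> chain_weight r t ord Z ga c = 0.
Proof.
elim: c ga Z => //= mu c IH ga Z; rewrite chain_weight_cons negb_and.
by case/orP => [/negPf ns|/IH->]; rewrite ?mulr0 // /strip_weight ns mul0r.
Qed.

(** * Coefficients of products *)

Section Monomials.
Implicit Types (m p : monom) (g h : {malg coef[monom]}).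

Lemma mcoeff_ucmM (i : nat + nat) g m : m i = 0%N -> (<< ucm i >> * g)@_m = 0.
Proof.
move=> mi0; rewrite mcoeffMl [X in X = _]big1 // => k1 _; rewrite big1 // => k2 _.
have [->|ne] := eqVneq k1 (ucm i); last by rewrite mcoeffU1 eq_sym (negPf ne) mul0r mul0rn.
case: eqP => [E|_]; last by rewrite mulr0n.
by move: mi0; rewrite -E cmM ucmE eqxx.
Qed.

Lemma mcoeffM_pairs g h m :
  (g * h)@_m = \sum_(p \in [set p : monom * monom | mmul p.1 p.2 = m]) g@_p.1 * h@_p.2.
Proof.
pose L := [seq (k1, k2) | k1 <- msupp g, k2 <- msupp h].
have uL : uniq L by apply: allpairs_uniq => // -[a b] [c d] _ _ [-> ->].
rewrite mcoeffMl; transitivity (\sum_(p <- L) (g@_p.1 * h@_p.2) *+ (mmul p.1 p.2 == m)).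
  by rewrite big_allpairs.
rewrite fsbig_seq //; pose S := [set p : monom * monom | mmul p.1 p.2 = m]%classic; rewrite -/S.
rewrite -(@fsbig_widen _ _ _ _ (S `&` [set` L])%classic [set` L]); last 2 first.
- by move=> p [].
- move=> p [pL nS] /=; case: eqP => [E|]; last by rewrite mulr0n.
  by exfalso; apply: nS.
rewrite -[RHS](@fsbig_widen _ _ _ _ (S `&` [set` L])%classic S); last 2 first.
- by move=> p [].
- move=> [a b] [pS nL] /=; apply/eqP; apply/negPn/negP => nz.
  apply: nL; split=> //; apply/allpairsP; exists (a, b) => /=.
  rewrite -!mcoeff_neq0; split=> //; apply: contraNneq nz => ->.
    by rewrite mul0r.
  by rewrite mulr0.
apply: eq_fsbigr => p; rewrite inE => -[pS _].
by move: pS; rewrite /S /= => ->; rewrite eqxx.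
Qed.

Lemma monom_bound m : exists N : nat, forall j, (N <= j)%N -> m (inl j) = 0%N /\ m (inr j) = 0%N.
Proof.
pose ix (i : nat + nat) := match i with inl j => j | inr j => j end.
exists (\max_(i <- finsupp (cmonom_val m)) (ix i).+1)%N => j le_j.
have aux i : ix i = j -> m i = 0%N.
  move=> ixi; apply/eqP; rewrite cmE_eq0; apply: contraTN le_j => iin; rewrite -ltnNge.
  by rewrite -ixi (big_rem i) //= leq_max leqnn.
by split; apply: aux.
Qed.
End Monomials.

(** * Tableaux as chains of fixed length, for either order and either set of variables *)

Section Tableaux.
Variables (r : nat) (ord : rel int) (v : nat -> nat + nat).
Hypotheses (r_gt0 : (0 < r)%N) (ord_tr : transitive ord).
Implicit Types (la mu nu ga : part) (P c : seq part) (p m : monom).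

Let Z (j : nat) : {malg coef[monom]} := << ucm (v j) >>.
Let t : {malg coef[monom]} := qhalf%:A.

Lemma chain_weight_path ga P : path (strip ord r) ga P ->
  chain_weight r t ord Z ga P = qhalf ^+ tableau_spin2 ord r ga P *:
    \prod_(j < size P) Z j ^+ strip_size ord r (nth ga (ga :: P) j) (nth ga P j).
Proof.
move=> /(pathP ga) pP; rewrite -mulr_algl.
have -> : (qhalf ^+ tableau_spin2 ord r ga P)%:A = t ^+ tableau_spin2 ord r ga P.
  by rewrite /t exprZn expr1n.
rewrite /tableau_spin2 expr_sum mulrC -big_split; apply: eq_bigr => j _ /=.
by rewrite /strip_weight pP.
Qed.

Lemma tableau_termE ga P p : path (strip ord r) ga P ->
  tableau_term ord r Z ga P p = (chain_weight r t ord Z ga P)@_p.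
Proof. by move=> pP; rewrite chain_weight_path. Qed.

(** The last strip of a shortest representative is nontrivial, so its term is divisible by the
    variable of index [size P - 1 >= N], which does not occur in [p]. *)
Lemma tableau_term_long N la ga P p : ribbon_tableau ord r la ga P -> (N < size P)%N ->
  (forall j, (N <= j)%N -> p (v j) = 0%N) -> tableau_term ord r Z ga P p = 0.
Proof.
move=> [pP _ canon] ltN p0; rewrite tableau_termE //.
case/lastP: P pP canon ltN => // P mu; rewrite rcons_path => /andP[pP st] canon.
rewrite size_rcons ltnS => leN.
rewrite chain_weight_rcons /strip_weight st.
case E : (strip_size _ _ _ _) => [|s].
  by have := canon P; rewrite -(strip_sizeP ord_tr st E).
move: (chain_weight _ _ _ _ _ _) (t ^+ _) => a b; rewrite exprS -mulrA mulrCA.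
by apply: mcoeff_ucmM; apply: p0.
Qed.

Lemma chain_weight_pad ga P d :
  chain_weight r t ord Z ga (P ++ nseq d (last ga P)) = chain_weight r t ord Z ga P.
Proof.
elim: d => [|d IH]; first by rewrite cats0.
rewrite -addn1 nseqD catA cats1 chain_weight_rcons IH last_cat.
have -> : last (last ga P) (nseq d (last ga P)) = last ga P by case: d {IH}=> //= d; elim: d.
by rewrite strip_weight_refl // mulr1.
Qed.

Lemma path_pad ga P d : path (strip ord r) ga (P ++ nseq d (last ga P)) = path (strip ord r) ga P.
Proof.
rewrite cat_path [X in _ && X](_ : _ = true) ?andbT //.
by elim: d => //= d ->; rewrite strip_refl.
Qed.

Lemma last_pad ga P d : last ga (P ++ nseq d (last ga P)) = last ga P.
Proof. by rewrite last_cat; case: d => //= d; elim: d. Qed.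

Lemma unpad ga c : exists P, [/\ (size P <= size c)%N,
  c = P ++ nseq (size c - size P) (last ga P) &
  forall P', P <> rcons P' (last ga P')].
Proof.
elim/last_ind: c => [|c mu [P [le_P Ec canon]]].
  by exists [::]; split=> // -[].
have lc : last ga c = last ga P by rewrite Ec last_pad.
have [E|ne] := eqVneq mu (last ga c).
  exists P; rewrite size_rcons; split=> //; first exact: ltnW.
  by rewrite subSn // -addn1 nseqD catA -Ec cats1 E lc.
exists (rcons c mu); rewrite subnn cats0; split=> // P' /rcons_inj[Ec' Emu].
by rewrite Emu -Ec' eqxx in ne.
Qed.

(** Of two sequences with equal paddings the longer one is itself a padding of the shorter, so a
    proper extension would end with a repetition. *)
Lemma pad_inj ga P Q : (forall P', P <> rcons P' (last ga P')) ->
  (forall P', Q <> rcons P' (last ga P')) ->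
  forall a b, P ++ nseq a (last ga P) = Q ++ nseq b (last ga Q) -> P = Q.
Proof.
move=> canP canQ.
suff main S T a b : (forall P', T <> rcons P' (last ga P')) -> (size S <= size T)%N ->
    S ++ nseq a (last ga S) = T ++ nseq b (last ga T) -> S = T.
  move=> a b E; have [le|/ltnW le] := leqP (size P) (size Q); first exact: main E.
  by symmetry; apply: main (esym E).
move=> canT le E; pose d := (size T - size S)%N.
have ET : T = S ++ nseq d (last ga S).
  rewrite -[LHS](@take_size_cat _ (size T) T (nseq b (last ga T))) // -E.
  rewrite take_cat ltnNge le /= take_nseq //.
  by have := congr1 size E; rewrite !size_cat !size_nseq /d; lia.
case: d ET => [|d] ET; first by rewrite ET cats0.
case: (canT (S ++ nseq d (last ga S))).
by rewrite last_pad {1}ET -addn1 nseqD catA cats1.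
Qed.

Section Window.
Variables (k : int) (n : nat).
Let B : seq part := fset_set (box (k + r%:Z) (k + n%:Z + r%:Z)).

Lemma strips_in_B ga P : path (strip ord r) ga P -> last ga P \in B -> all [in B] P.
Proof.
move=> pP lB; apply/allP => nu nuP; apply: (down_B r_gt0) lB => d.
exact: sub_strips_mem pP _ nuP.
Qed.

Lemma finite_short_tableaux N la ga : la \in B ->
  finite_set [set P | ribbon_tableau ord r la ga P /\ (size P <= N)%N].
Proof.
move=> laB; have := finite_bounded_seq N (finite_box (k + r%:Z) (k + n%:Z + r%:Z)).
apply: sub_finite_set => P [[pP lP _] szP]; split=> // nu nuP; apply/mem_B.
by apply: (allP _ _ nuP); apply: strips_in_B pP _; rewrite lP.
Qed.

Lemma tableaux_sum N la ga p : la \in B -> (forall j, (N <= j)%N -> p (v j) = 0%N) ->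
  fps_sum (ribbon_tableau ord r la ga) (tableau_term ord r Z ga) p =
  (\sum_(c <- words B N) if last ga c == la then chain_weight r t ord Z ga c else 0)@_p.
Proof.
move=> laB p0; rewrite /fps_sum.
set T := ribbon_tableau _ _ _ _.
pose TN := [set P | T P /\ (size P <= N)%N]%classic.
pose S := [set c | [/\ path (strip ord r) ga c, last ga c = la & size c = N]]%classic.
rewrite -(@fsbig_widen _ _ _ _ TN T); last 2 first.
- by move=> P [].
- move=> P [TP nTN] /=; apply: tableau_term_long (TP) _ p0.
  by rewrite ltnNge; apply/negP => le; apply: nTN.
(* Padding to length [N] adds trivial strips only, each of weight 1, and is inverted by [unpad]. *)
pose h P := P ++ nseq (N - size P) (last ga P).
have bij_h : set_bij TN S h.
  split=> [P [[pP lP cP] szP]|P Q|c [pc lc szc]].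
  - split; rewrite /h ?path_pad ?last_pad // size_cat size_nseq; lia.
  - by rewrite !inE => -[[_ _ cP] _] [[_ _ cQ] _]; exact: pad_inj.
  have [P [le Ec canon]] := unpad ga c; exists P; last by rewrite /h -szc -Ec.
  split; last by rewrite -szc.
  by split=> //; [rewrite Ec path_pad in pc|rewrite Ec last_pad in lc].
pose F c := if last ga c == la then chain_weight r t ord Z ga c else 0.
transitivity (\sum_(P \in TN) (F (h P))@_p).
  apply: eq_fsbigr => P; rewrite inE => -[[pP lP _] _].
  by rewrite tableau_termE // /F /h last_pad chain_weight_pad lP eqxx.
rewrite -(reindex_fsbig h TN S (fun c => (F c)@_p)) // raddf_sum /= [RHS]fsbig_seq; last first.
  by apply: uniq_words; exact: fset_uniq.
apply: fsbig_widen => [c [pc lc szc] /=|c [/= cw nS]].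
  by rewrite mem_words szc eqxx (strips_in_B pc) // lc.
move: cw; rewrite mem_words /F => /andP[/eqP szc _].
case: eqP => [lc|_]; last by rewrite mcoeff0.
rewrite chain_weight_npath ?mcoeff0 //; apply/negP => pc; exact: nS.
Qed.

End Window.

Lemma tableaux_summable la ga :
  (forall m, exists N, forall j, (N <= j)%N -> m (v j) = 0%N) ->
  fps_summable (ribbon_tableau ord r la ga) (tableau_term ord r Z ga).
Proof.
move=> bound m; have [N m0] := bound m; have [k [n [fk z]]] := window_exists r la.
have laB : la \in (fset_set (box (k + r%:Z) (k + n%:Z + r%:Z)) : seq part) by apply/mem_B.
apply: sub_finite_set (finite_short_tableaux N ga laB) => P [TP /= nz]; split=> //.
rewrite leqNgt; apply: contraNN nz => lt; apply/eqP; exact: tableau_term_long TP lt m0.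
Qed.

Lemma tableaux_sum_eq0 N la ga p : (forall j, (N <= j)%N -> p (v j) = 0%N) ->
  (forall P, path (strip ord r) ga P -> last ga P = la -> (size P <= N)%N -> False) ->
  fps_sum (ribbon_tableau ord r la ga) (tableau_term ord r Z ga) p = 0.
Proof.
move=> p0 none; apply: fsbig1 => P TP; apply: tableau_term_long (TP) _ p0.
by rewrite ltnNge; apply/negP; have [pP lP _] := TP; exact: none.
Qed.

End Tableaux.

Lemma full_hstrips (r : nat) (b : int) (ga : part) (P : seq part) : (0 < r)%N ->
  path (strip <%R r) ga P -> full b ga -> full (b - (r * size P)%:Z) (last ga P).
Proof.
move=> r_gt0; elim: P b ga => [|mu P IH] b ga /=; first by rewrite muln0 subr0.
move=> /andP[st pP] fb; have := IH _ _ pP (full_hstrip r_gt0 st fb).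
by apply: full_le; lia.
Qed.

Lemma beads_vstrips (r : nat) (M : int) (ga : part) (P : seq part) : (0 < r)%N ->
  path (strip >%R r) ga P -> beads ga M = 0%N -> beads (last ga P) (M + (r * size P)%:Z) = 0%N.
Proof.
move=> r_gt0; elim: P M ga => [|mu P IH] M ga /=; first by rewrite muln0 addr0.
move=> /andP[st pP] z; have := IH _ _ pP (beads_vstrip r_gt0 st z).
by move=> E; apply/eqP; rewrite -leqn0 -E; apply: beads_anti; lia.
Qed.

Lemma core_can_dn (r : nat) (ga : part) : (0 < r)%N -> is_core r ga ->
  forall j, ~~ can_dn r j ga.
Proof.
move=> r_gt0 core j; apply/negP => Dj; have hj := dnP r_gt0 Dj.
have E : dn r j ga = ga.
  by apply: core; exists [:: ga]; split=> //=; rewrite andbT; apply/ribbonP; exists j.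
have := hj (j + 1); rewrite E (_ : (j < j + 1 <= j + r%:Z) = true); lia.
Qed.

(** * Convergence of the product *)

Lemma window_core (r N : nat) (ga : part) : exists (k : int) (n : nat),
  full (k + r%:Z + (r * N)%:Z) ga /\ beads ga (k + n%:Z - (r * N)%:Z) = 0%N.
Proof.
(* The values make the two bounds exactly [- size ga] and [row ga 0]: positions below the first are
   all occupied, those from the second on are free. *)
exists (- (size ga)%:Z - r%:Z - (r * N)%:Z), (size ga + row ga 0 + r + 2 * (r * N))%N; split.
  by rewrite /full beads_lo; lia.
by rewrite beads_hi //; lia.
Qed.

(** * The coefficient of one monomial *)

Section Coefficients.
Variables (r N : nat) (ga : part) (m : monom) (k : int) (n : nat).
Hypotheses (r_gt0 : (0 < r)%N) (core : is_core r ga).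
Hypothesis m_bound : forall j, (N <= j)%N -> m (inl j) = 0%N /\ m (inr j) = 0%N.
Hypothesis ga_full : full (k + r%:Z + (r * N)%:Z) ga.
Hypothesis ga_beads : beads ga (k + n%:Z - (r * N)%:Z) = 0%N.

Let B : seq part := fset_set (box (k + r%:Z) (k + n%:Z + r%:Z)).
Let t : {malg coef[monom]} := qhalf%:A.
Let H la : {malg coef[monom]} :=
  \sum_(c <- words B N) if last ga c == la then chain_weight r t <%R varX ga c else 0.
Let V la : {malg coef[monom]} :=
  \sum_(c <- words B N) if last ga c == la then chain_weight r t >%R varY ga c else 0.

Let divisor_bound (p : monom * monom) : mmul p.1 p.2 = m -> forall j, (N <= j)%N ->
  p.1 (inl j) = 0%N /\ p.2 (inr j) = 0%N.
Proof.
move=> Ep j /m_bound; rewrite -Ep !cmM => -[h1 h2].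
by split; lia.
Qed.

Lemma fps_mul_in la : la \in B ->
  fps_mul (G r la ga varX) (Gt r la ga varY) m = (H la * V la)@_m.
Proof.
move=> laB; rewrite mcoeffM_pairs; apply: eq_fsbigr => p; rewrite inE => Ep.
congr (_ * _).
  apply: (@tableaux_sum r <%R inl r_gt0 lt_trans k n N) => // j le_j.
  by have [] := divisor_bound Ep le_j.
apply: (@tableaux_sum r >%R inr r_gt0 gt_trans k n N) => // j le_j.
by have [] := divisor_bound Ep le_j.
Qed.

(** The two series guard one end each: [N] horizontal strips from [ga] cannot empty positions below
    [k + r], and [N] vertical strips cannot carry a bead to [k + n + r]. Outside the box one of the
    factors has no short tableaux at all. *)
Lemma fps_mul_notin la : la \notin B ->
  fps_mul (G r la ga varX) (Gt r la ga varY) m = 0.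
Proof.
move=> laB; apply: fsbig1 => p Ep.
have [fla|nfla] := EM (full (k + r%:Z) la); last first.
  rewrite [G _ _ _ _ _](_ : _ = 0) ?mul0r //.
  apply: (@tableaux_sum_eq0 r <%R inl lt_trans N) => [j le_j|P pP lP szP].
    by have [] := divisor_bound Ep le_j.
  apply: nfla; rewrite -lP; have := full_hstrips r_gt0 pP ga_full.
  by apply: full_le; nia.
rewrite [Gt _ _ _ _ _](_ : _ = 0) ?mulr0 //.
apply: (@tableaux_sum_eq0 r >%R inr gt_trans N) => [j le_j|P pP lP szP].
  by have [] := divisor_bound Ep le_j.
move/negP: laB; apply; apply/mem_B; split=> //.
have E := beads_vstrips r_gt0 pP ga_beads; rewrite lP in E.
by apply/eqP; rewrite -leqn0 -E; apply: beads_anti; nia.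
Qed.

Lemma fps_sum_cauchy :
  fps_sum (RH r ga) (fun la => fps_mul (G r la ga varX) (Gt r la ga varY)) m =
  (\prod_(i < N) \prod_(j < N) \prod_(l < r) (1 + q ^+ l *: (varX i * varY j)))@_m.
Proof.
have -> : \prod_(i < N) \prod_(j < N) \prod_(l < r) (1 + q ^+ l *: (varX i * varY j)) =
    \prod_(i < N) \prod_(j < N) kernel r t (varX i) (varY j).
  apply: eq_bigr => i _; apply: eq_bigr => j _; apply: eq_bigr => l _.
  by rewrite /t exprZn expr1n mulr_algl /q exprM.
transitivity ((\sum_(la <- B) H la * V la)@_m); last first.
  by congr mcoeff; apply: chain_sum_cauchy => //; apply: core_can_dn.
(* The sum over [B] also contains partitions that no chain from [ga] reaches; they contribute 0. *)
have H0 la : ~ RH r ga la -> H la = 0.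
  move=> nRH; rewrite /H big1 // => c _; case: eqP => // lc.
  apply: chain_weight_npath; apply/negP => pc; apply: nRH; rewrite -lc.
  exact: ribbon_le_strips pc.
rewrite raddf_sum fsbig_seq ?fset_uniq // /fps_sum.
pose W := (RH r ga `&` [set` B])%classic.
rewrite -(@fsbig_widen _ _ _ _ W (RH r ga)); last 2 first.
- by move=> la [].
- move=> la [RHla nW] /=; apply: fps_mul_notin; apply/negP => laB; exact: nW.
rewrite -[RHS](@fsbig_widen _ _ _ _ W [set` B]%classic); last 2 first.
- by move=> la [].
- move=> la [laB nW]; rewrite /preimage /set1 /mkset H0 ?mul0r ?raddf0 // => RHla.
  exact: nW.
by apply: eq_fsbigr => la; rewrite inE => -[_ laB]; exact: fps_mul_in.
Qed.

(** A factor with [i >= N] or [j >= N] is 1 plus a multiple of a variable absent from [m], so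
    multiplying by it does not change the coefficient of [m]. *)
Lemma prod_stable (J : {fset nat * nat}) :
  ([fset ij in [seq (i, j) | i <- iota 0 N, j <- iota 0 N]] `<=` J)%fset ->
  (\prod_(ij <- J) \prod_(l < r) (1 + q ^+ l *: (varX ij.1 * varY ij.2)))@_m =
  (\prod_(i < N) \prod_(j < N) \prod_(l < r) (1 + q ^+ l *: (varX i * varY j)))@_m.
Proof.
set L := [seq _ | i <- _, j <- _] => /fsubsetP subJ.
have uL : uniq L by apply: allpairs_uniq; rewrite ?iota_uniq // => -[a b] [c d] _ _ [-> ->].
pose F (ij : nat * nat) : {malg coef[monom]} :=
  \prod_(l < r) (1 + q ^+ l *: (varX ij.1 * varY ij.2)).
have pL : perm_eq [seq ij <- J | ij \in L] L.
  apply: uniq_perm => [|//|ij]; first by rewrite filter_uniq ?fset_uniq.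
  rewrite mem_filter andb_idr // => ijL; apply: subJ.
  by rewrite in_fset.
rewrite (bigID [in L]) /= -/F -big_filter (perm_big _ pL) /= big_allpairs.
have -> : \prod_(i <- iota 0 N) \prod_(j <- iota 0 N)
      \prod_(l < r) (1 + q ^+ l *: (varX (i, j).1 * varY (i, j).2)) =
    \prod_(i < N) \prod_(j < N) \prod_(l < r) (1 + q ^+ l *: (varX i * varY j)).
  rewrite -[N in iota 0 N]subn0 -/(index_iota 0 N) big_mkord.
  by apply: eq_bigr => i _; rewrite big_mkord.
pose stable (a : {malg coef[monom]}) := forall g, (g * a)@_m = g@_m.
have stable1 : stable 1 by move=> g; rewrite mulr1.
have stableM a b : stable a -> stable b -> stable (a * b).
  by move=> sa sb g; rewrite mulrA sb sa.
suff stableF ij : ij \notin L -> stable (F ij).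
  exact: (@big_ind _ stable _ _ stable1 stableM _ J (fun ij => ij \notin L) F stableF).
case: ij => i j nL; apply: (big_ind stable stable1 stableM) => l _ g.
rewrite mulrDr mulr1 mcoeffD -scalerAr mcoeffZ.
rewrite [X in _ + _ * X](_ : _ = 0) ?mulr0 ?addr0 //= mulrC -mulrA.
have [lt_i|le_i] := ltnP i N; last by apply: mcoeff_ucmM; have [] := m_bound le_i.
have [lt_j|le_j] := ltnP j N.
  by move: nL; rewrite allpairs_f // mem_iota.
by rewrite mulrCA; apply: mcoeff_ucmM; have [] := m_bound le_j.
Qed.

End Coefficients.

Unset Implicit Arguments.

Theorem mainTheorem6 (r : nat) (ga : part) (hr : (0 < r)%N)
    (hga : is_core r ga) :
  [/\ forall la : part, RH r ga la ->
        fps_summable (ribbon_tableau <%R r la ga) (tableau_term <%R r varX ga),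
      forall la : part, RH r ga la ->
        fps_summable (ribbon_tableau >%R r la ga) (tableau_term >%R r varY ga),
      fps_summable (RH r ga)
        (fun la => fps_mul (G r la ga varX) (Gt r la ga varY)) &
      has_prod
        (fun ij : nat * nat =>
           \prod_(k < r) (1 + q ^+ k *: (varX ij.1 * varY ij.2)))
        (fps_sum (RH r ga)
           (fun la => fps_mul (G r la ga varX) (Gt r la ga varY)))].
Proof.
split=> [la _|la _|m|m]; have := monom_bound.
- move=> bound; apply: (@tableaux_summable r <%R inl hr lt_trans) => m.
  by have [N mN] := bound m; exists N => j /mN[].
- move=> bound; apply: (@tableaux_summable r >%R inr hr gt_trans) => m.
  by have [N mN] := bound m; exists N => j /mN[].
- case/(_ m) => N mN; have [k [n [fga bga]]] := window_core r N ga.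
  apply: sub_finite_set (finite_box (k + r%:Z) (k + n%:Z + r%:Z)) => la [_ /= nz].
  apply/mem_B; apply: contraNT nz => laB.
  by rewrite (fps_mul_notin hr mN fga bga laB).
case/(_ m) => N mN; have [k [n [fga bga]]] := window_core r N ga.
exists [fset ij in [seq (i, j) | i <- iota 0 N, j <- iota 0 N]]%fset => J subJ.
by rewrite (fps_sum_cauchy hr hga mN fga bga) -(prod_stable r mN subJ).
Qed.
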